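(* Let $F$ be a finite field with $q$ elements, let $d\ge 1$, and let $A\in M_d(F[t])$ with $\det(A)\neq 0$. Consider the multiplication-by-$A$ map $A:\mathbb{T}_F^d\to\mathbb{T}_F^d$. Let $h(\mu^d,A)$ be the measure-theoretic entropy of $A$ with respect to $\mu^d$ and $h(A)$ its topological entropy. Let $\lambda_1,\ldots,\lambda_d$ be the eigenvalues of $A$ (with multiplicity, in an algebraic closure of $\mathbb{R}_F$). Then $$h(A)=h(\mu^d,A)=\sum_{i=1}^d\log\max\{|\lambda_i|,1\}.$$
   Context: $\mathbb{Z}_F=F[t]$, $\mathbb{R}_F=F((1/t))=\{\sum_{i\le m}a_it^i: m\in\mathbb{Z}, a_i\in F\}$ with valuation $v(\sum_{i\le m}a_it^i)=-m$ when $a_m\ne0$, $v(0)=\infty$, and absolute value $|x|=q^{-v(x)}$; this absolute value is extended uniquely to a fixed algebraic closure of $\mathbb{R}_F$. $\mathbb{T}_F=\mathbb{R}_F/\mathbb{Z}_F$ is a compact abelian group; every $\alpha\in\mathbb{T}_F$ has a unique preimage $\tilde\alpha\in\mathbb{R}_F$ of the form $\sum_{i\le -1}a_it^i$. $\mu$ is the probability Haar measure on $\mathbb{T}_F$ and $\mu^d$ the product measure on $\mathbb{T}_F^d$. $\mathbb{T}_F^d$ carries the metric $\rho_{(d)}((\alpha_1,\dots,\alpha_d),(\beta_1,\dots,\beta_d))=\max_i|\tilde\alpha_i-\tilde\beta_i|$. Since $A\mathbb{Z}_F^d\subseteq\mathbb{Z}_F^d$, multiplication by $A$ on $\mathbb{R}_F^d$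 induces a map on $\mathbb{T}_F^d$, which is a surjective endomorphism preserving $\mu^d$ when $\det A\ne0$. *)

(* Defs.v *)
From HB Require Import structures.
From mathcomp Require Import all_boot all_order all_algebra.
From mathcomp Require Import all_classical all_reals all_analysis.
From mathcomp Require Import ring.
Import Order.TTheory GRing.Theory Num.Theory.
Import numFieldNormedType.Exports.

Set Implicit Arguments.
Unset Strict Implicit.
Unset Printing Implicit Defensive.

Local Open Scope classical_set_scope.
Local Open Scope ring_scope.

(* The field [F((1/t))]: [x i] is the coefficient of [t^i] in [x]. *)
Record laurent (F : fieldType) := Laurent {
  lcoef :> int -> F;
  lcoef_bounded : exists m : int, forall i, m < i -> lcoef i = 0 }.

HB.instance Definition _ (F : fieldType) := gen_eqMixin (laurent F).
HB.instance Definition _ (F : fieldType) := gen_choiceMixin (laurent F).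

Section LaurentField.
Variable F : fieldType.
Implicit Types (x y z : laurent F) (m n i k : int) (p : {poly F}).

Lemma laurentP x y : lcoef x =1 lcoef y -> x = y.
Proof.
case: x y => [f hf] [g hg] /= /funext efg; move: hf hg; rewrite efg => hf hg.
by rewrite (Prop_irrelevance hf hg).
Qed.

Definition lbound m x := forall i, m < i -> x i = 0.

Lemma lbound_ex x : exists m, lbound m x.
Proof. by case: x => f [m hm]; exists m. Qed.

Lemma lboundW m n x : m <= n -> lbound m x -> lbound n x.
Proof. by move=> mn hm i ni; apply: hm; apply: le_lt_trans ni. Qed.

Lemma lbound_ex2 x y : exists m, lbound m x /\ lbound m y.
Proof.
have [m hm] := lbound_ex x; have [n hn] := lbound_ex y.
exists (Num.max m n); split; apply: lboundW; try eassumption.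
  by rewrite le_max lexx.
by rewrite le_max lexx orbT.
Qed.

Lemma lzero_subproof : exists m : int, forall i, m < i -> (0 : F) = 0.
Proof. by exists 0. Qed.
Definition lzero : laurent F := Laurent lzero_subproof.

Lemma ladd_subproof x y : exists m : int, forall i, m < i -> x i + y i = 0.
Proof.
by have [m [hx hy]] := lbound_ex2 x y; exists m => i mi; rewrite hx ?hy ?addr0.
Qed.
Definition ladd x y : laurent F := Laurent (ladd_subproof x y).

Lemma lopp_subproof x : exists m : int, forall i, m < i -> - x i = 0.
Proof. by have [m hx] := lbound_ex x; exists m => i /hx ->; rewrite oppr0. Qed.
Definition lopp x : laurent F := Laurent (lopp_subproof x).

Lemma laddA : associative ladd.
Proof. by move=> x y z; apply: laurentP => i; rewrite /= addrA. Qed.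
Lemma laddC : commutative ladd.
Proof. by move=> x y; apply: laurentP => i; rewrite /= addrC. Qed.
Lemma ladd0 : left_id lzero ladd.
Proof. by move=> x; apply: laurentP => i; rewrite /= add0r. Qed.
Lemma laddN : left_inverse lzero lopp ladd.
Proof. by move=> x; apply: laurentP => i; rewrite /= addNr. Qed.

HB.instance Definition _ :=
  GRing.isZmodule.Build (laurent F) laddA laddC ladd0 laddN.

Lemma lcoefD x y i : (x + y) i = x i + y i. Proof. by []. Qed.
Lemma lcoefN x i : (- x) i = - x i. Proof. by []. Qed.
Lemma lcoefB x y i : (x - y) i = x i - y i. Proof. by []. Qed.
Lemma lcoef0 i : (0 : laurent F) i = 0. Proof. by []. Qed.

(* The sum has only finitely many nonzero terms, so the finitely-supported
   sum over all integers is the Cauchy product. *)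
Definition lmul_coef x y k : F := \sum_(i \in [set: int]) x i * y (k - i).

Lemma lmul_coef_bound m n x y k :
  lbound m x -> lbound n y -> m + n < k -> lmul_coef x y k = 0.
Proof.
move=> hx hy mnk; apply: fsbig1 => i _.
have [mi|im] := ltP m i; first by rewrite hx ?mul0r.
rewrite hy ?mulr0// ltrBrDl; apply: le_lt_trans mnk.
by rewrite lerD2r.
Qed.

Lemma lmul_subproof x y : exists m, forall i, m < i -> lmul_coef x y i = 0.
Proof.
have [m hx] := lbound_ex x; have [n hy] := lbound_ex y.
by exists (m + n) => i; apply: lmul_coef_bound.
Qed.
Definition lmul x y : laurent F := Laurent (lmul_subproof x y).

(* Truncations of [x], read downwards from degree [m], as polynomials; ring
   identities on [laurent F] are obtained from those on [{poly F}]. *)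
Definition ltrunc m (N : nat) x : {poly F} := \poly_(j < N) x (m - j%:Z).

Lemma lmulE m n (N l : nat) x y : lbound m x -> lbound n y -> (l < N)%N ->
  lmul x y (m + n - l%:Z) = (ltrunc m N x * ltrunc n N y)`_l.
Proof.
move=> hx hy lN; rewrite /= /lmul_coef.
rewrite (fsbigE [seq m - j%:Z | j <- iota 0 l.+1]); last 3 first.
- rewrite map_inj_uniq ?iota_uniq// => a b /addrI /oppr_inj [].
  by [].
- by [].
- move=> i _ /mapP ni.
  have [mi|im] := ltP m i; first by rewrite hx ?mul0r.
  have [ej] : exists j : nat, i = m - j%:Z.
    have : 0 <= m - i by rewrite subr_ge0.
    by case E: (m - i) => [j|//] _; exists j; rewrite -E opprB addrC subrK.
  move=> ei; have lej : (l < ej)%N.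
    rewrite ltnNge; apply/negP => ejl; apply: ni; exists ej => //.
    by rewrite mem_iota /= add0n ltnS.
  rewrite hy ?mulr0// ei opprB addrACA -subr_gt0.
  rewrite (_ : _ - n = ej%:Z - l%:Z); last first.
    by rewrite -addrA addrA addrAC; ring.
  by rewrite subr_gt0 ltz_nat.
rewrite big_map coefM -(big_mkord xpredT
  (fun j => (ltrunc m N x)`_j * (ltrunc n N y)`_(l - j))).
rewrite /index_iota subn0; under eq_bigl do rewrite in_setT.
apply: eq_big_seq => j; rewrite mem_iota /= add0n ltnS => jl.
rewrite !coef_poly (leq_ltn_trans jl lN) (leq_ltn_trans (leq_subr j l) lN).
congr (_ * _); congr (lcoef y _).
by rewrite -subzn //; ring.
Qed.

Lemma coefM_congr (p p' q q' : {poly F}) (l : nat) :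
  (forall j, (j <= l)%N -> p`_j = p'`_j) ->
  (forall j, (j <= l)%N -> q`_j = q'`_j) -> (p * q)`_l = (p' * q')`_l.
Proof.
move=> hp hq; rewrite !coefM; apply: eq_bigr => j _.
by rewrite hp ?hq ?leq_subr// -ltnS.
Qed.

Lemma ltruncM m n N x y j : lbound m x -> lbound n y -> (j < N)%N ->
  (ltrunc (m + n) N (lmul x y))`_j = (ltrunc m N x * ltrunc n N y)`_j.
Proof. by move=> hx hy jN; rewrite coef_poly jN; apply: lmulE. Qed.

Lemma lmul_bound m n x y : lbound m x -> lbound n y -> lbound (m + n) (lmul x y).
Proof. by move=> hx hy k; apply: lmul_coef_bound. Qed.

Lemma lbound_eq m x y : lbound m x -> lbound m y ->
  (forall l : nat, x (m - l%:Z) = y (m - l%:Z)) -> x = y.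
Proof.
move=> hx hy exy; apply: laurentP => i.
have [mi|im] := ltP m i; first by rewrite hx ?hy.
have : 0 <= m - i by rewrite subr_ge0.
case E: (m - i) => [j|//] _; have <- : m - j%:Z = i by rewrite -E opprB addrC subrK.
exact: exy.
Qed.

Lemma lmulC : commutative lmul.
Proof.
move=> x y; have [m [hx hy]] := lbound_ex2 x y.
apply: (@lbound_eq (m + m)); try exact: lmul_bound.
by move=> l; rewrite !(@lmulE _ _ l.+1)// mulrC.
Qed.

Lemma lmulA : associative lmul.
Proof.
move=> x y z; have [m hx] := lbound_ex x; have [n hy] := lbound_ex y.
have [r hz] := lbound_ex z.
have hxy := lmul_bound hx hy; have hyz := lmul_bound hy hz.
have hl : lbound (m + n + r) (lmul x (lmul y z)).
  by rewrite -addrA; exact: lmul_bound.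
apply: (lbound_eq hl); first exact: lmul_bound.
move=> l; rewrite [RHS](@lmulE (m + n) r l.+1)//.
rewrite -[X in X - _]addrA [LHS](@lmulE m (n + r) l.+1)//.
transitivity ((ltrunc m l.+1 x * (ltrunc n l.+1 y * ltrunc r l.+1 z))`_l).
  by apply: coefM_congr => // j jl; rewrite ltruncM.
rewrite mulrA; apply/esym/coefM_congr => // j jl.
by rewrite ltruncM.
Qed.

Lemma lmulDl : left_distributive lmul ladd.
Proof.
move=> x y z; have [m [hx hy]] := lbound_ex2 x y; have [n hz] := lbound_ex z.
have hxy : lbound m (ladd x y) by move=> i mi; rewrite /= hx ?hy ?addr0.
apply: (@lbound_eq (m + n)); first exact: lmul_bound.
  move=> i mi; change (lmul x z i + lmul y z i = 0).
  by rewrite (lmul_bound hx hz)// (lmul_bound hy hz)// addr0.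
move=> l; change (lmul (ladd x y) z (m + n - l%:Z) =
  lmul x z (m + n - l%:Z) + lmul y z (m + n - l%:Z)).
rewrite !(@lmulE _ _ l.+1)// -coefD -mulrDl; apply: coefM_congr => // j jl.
by rewrite coefD !coef_poly ltnS jl.
Qed.

Definition poly_coef (p : {poly F}) (i : int) : F :=
  if i is Posz n then p`_n else 0.

Lemma poly_coef_bound p i : (size p)%:Z < i -> poly_coef p i = 0.
Proof.
by case: i => [n|//] /=; rewrite ltz_nat => sp; rewrite nth_default// ltnW.
Qed.

Lemma laurent_of_poly_subproof p :
  exists m : int, forall i, m < i -> poly_coef p i = 0.
Proof. by exists (size p)%:Z => i; apply: poly_coef_bound. Qed.

Definition laurent_of_poly (p : {poly F}) : laurent F :=
  Laurent (laurent_of_poly_subproof p).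

Lemma lbound_poly p (n : nat) : (size p <= n.+1)%N -> lbound n (laurent_of_poly p).
Proof.
move=> sp [k|//] /=; rewrite ltz_nat => nk.
by rewrite nth_default// (leq_trans sp).
Qed.

Lemma lmul1 : left_id (laurent_of_poly 1) lmul.
Proof.
move=> x; have [m hx] := lbound_ex x.
have h1 : lbound 0 (laurent_of_poly 1).
  by apply: (@lbound_poly 1 0); rewrite size_polyC oner_neq0.
apply: (@lbound_eq (0 + m)); [exact: lmul_bound|by rewrite add0r|].
move=> l; rewrite (@lmulE _ _ l.+1)//.
rewrite (@coefM_congr _ 1 _ (ltrunc m l.+1 x))// => [|j jl].
  by rewrite mul1r coef_poly ltnSn add0r.
rewrite coef_poly ltnS jl sub0r coef1.
by case: j jl => [|j] jl //=; rewrite coef1.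
Qed.

Lemma lone_neq0 : laurent_of_poly 1 != 0.
Proof.
apply/eqP => /(congr1 (fun x => lcoef x 0)); rewrite /= coef1 eqxx => /eqP.
by rewrite oner_eq0.
Qed.

HB.instance Definition _ := GRing.Zmodule_isComNzRing.Build (laurent F)
  lmulA lmulC lmul1 lmulDl lone_neq0.

Lemma lcoefM x y k : (x * y) k = \sum_(i \in [set: int]) x i * y (k - i).
Proof. by []. Qed.

Lemma lcoef1 k : (1 : laurent F) k = (k == 0)%:R.
Proof. by case: k => [k|k] //; rewrite -[LHS]/((1 : {poly F})`_k) coef1. Qed.

(* The degree in [t]; it is [0] by convention when [x = 0]. *)
Definition ldeg x : int := xget 0 [set m | x m != 0 /\ lbound m x].

Lemma ldegP x : x != 0 -> x (ldeg x) != 0 /\ lbound (ldeg x) x.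
Proof.
move=> x0; rewrite /ldeg; case: xgetP => [m _ //|noM]; exfalso.
have [m hm] := lbound_ex x.
have shift k : x k != 0 -> exists j : nat, k = m - j%:Z.
  move=> xk; have : 0 <= m - k.
    by rewrite subr_ge0 leNgt; apply: contra xk => /hm ->.
  by case E: (m - k) => [j|//] _; exists j; rewrite -E opprB addrC subrK.
have exl : exists l : nat, x (m - l%:Z) != 0.
  apply: contrapT => nox; move/eqP: x0; apply.
  apply: (lbound_eq hm) => // l; rewrite lcoef0; apply/eqP.
  by apply: contrapT => /negP xl; apply: nox; exists l.
have [l0 xl0 minl] := ex_minnP exl.
apply: (noM (m - l0%:Z)); split => // k lk.
apply/eqP/negPn/negP => xk; have [j ek] := shift _ xk.
have := minl j; rewrite -ek => /(_ xk); rewrite leqNgt => /negP; apply.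
by move: lk; rewrite ek ltrD2l ltrN2 ltz_nat.
Qed.

(* Coefficients of the inverse of a power series with coefficients [f],
   [f 0 != 0]: [linv_seq f n] lists the first [n] of them. *)
Fixpoint linv_seq (f : nat -> F) (n : nat) : seq F :=
  if n is n'.+1 then
    let s := linv_seq f n' in
    rcons s ((f 0%N)^-1 * ((n' == 0%N)%:R - \sum_(j < n') s`_j * f (n' - j)%N))
  else [::].

Definition linv_coef f (n : nat) : F := (linv_seq f n.+1)`_n.

Lemma size_linv_seq f (n : nat) : size (linv_seq f n) = n.
Proof. by elim: n => //= n IH; rewrite size_rcons IH. Qed.

Lemma nth_linv_seq f (n j : nat) :
  (j < n)%N -> (linv_seq f n)`_j = linv_coef f j.
Proof.
elim: n => // n IH; rewrite ltnS leq_eqVlt => /predU1P[->//|jn].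
by rewrite /= nth_rcons size_linv_seq jn IH.
Qed.

Lemma linv_coefE (f : nat -> F) (n : nat) : f 0%N != 0 ->
  \sum_(j < n.+1) linv_coef f j * f (n - j)%N = (n == 0%N)%:R.
Proof.
move=> f0; rewrite big_ord_recr /= subnn {2}/linv_coef /= nth_rcons.
rewrite size_linv_seq ltnn eqxx mulrAC mulVf// mul1r addrC.
rewrite (eq_bigr (fun j : 'I_n => linv_coef f j * f (n - j)%N)) ?subrK//.
by move=> j _; rewrite nth_linv_seq.
Qed.

Definition linv_fun x k : F :=
  if - ldeg x - k is Posz n then linv_coef (fun j => x (ldeg x - j%:Z)) n else 0.

Lemma linv_subproof x : exists m : int, forall i, m < i -> linv_fun x i = 0.
Proof.
exists (- ldeg x) => i; rewrite -subr_lt0 /linv_fun.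
by case: (_ - _).
Qed.

Definition linv x : laurent F :=
  if x == 0 then 0 else Laurent (linv_subproof x).

Lemma lmulV x : x != 0 -> linv x * x = 1.
Proof.
move=> x0; have [xd hx] := ldegP x0; rewrite /linv (negbTE x0).
set m := ldeg x in xd hx *; set y := Laurent _.
have hy : lbound (- m) y.
  by move=> i; rewrite -subr_lt0 /= /linv_fun -/m; case: (_ - _).
have h1 : lbound 0 (1 : laurent F).
  by apply: (@lbound_poly 1 0); rewrite size_polyC oner_neq0.
apply: (@lbound_eq (- m + m)); [exact: lmul_bound|by rewrite addNr|].
move=> l; rewrite [LHS](@lmulE _ _ l.+1)// addNr sub0r.
transitivity ((l == 0%N)%:R : F); last by rewrite lcoef1 oppr_eq0.
rewrite -(@linv_coefE (fun j => x (m - j%:Z)))/= ?subr0//.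
rewrite coefM; apply: eq_bigr => j _.
rewrite !coef_poly ltn_ord ltnS leq_subr /= /linv_fun -/m.
by rewrite opprB addrC subrK.
Qed.

Lemma linv0 : linv 0 = 0. Proof. by rewrite /linv eqxx. Qed.

HB.instance Definition _ := GRing.ComNzRing_isField.Build (laurent F) lmulV linv0.

Lemma laurent_of_poly_is_zmod_morphism : zmod_morphism laurent_of_poly.
Proof.
by move=> p q; apply: laurentP => -[k|k] /=; rewrite ?coefB ?subr0.
Qed.

Lemma laurent_of_poly_is_monoid_morphism : monoid_morphism laurent_of_poly.
Proof.
split=> // p q.
apply: laurentP => -[k|k] /=; rewrite /lmul_coef.
  rewrite (fsbigE [seq j%:Z | j <- iota 0 k.+1]); last 3 first.
  - by rewrite map_inj_uniq ?iota_uniq// => a b [].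
  - by [].
  - case=> [i|i] _ ni /=; last by rewrite mul0r.
    case E: (k%:Z - i%:Z) => [j|j]; last by rewrite mulr0.
    exfalso; move/mapP: ni; apply; exists i => //.
    rewrite mem_iota /= add0n ltnS -lez_nat -subr_ge0.
    by rewrite [leRHS]E.
  rewrite big_map coefM -(big_mkord xpredT (fun j => p`_j * q`_(k - j))).
  rewrite /index_iota subn0; under [RHS]eq_bigl do rewrite in_setT.
  apply: eq_big_seq => j; rewrite mem_iota /= add0n ltnS => jk.
  by rewrite subzn.
apply/esym/fsbig1 => -[i|i] _; last by rewrite mul0r.
rewrite [X in _ * X](_ : _ = 0) ?mulr0// -[LHS]/(poly_coef q (Negz k - i%:Z)).
have : Negz k - i%:Z < 0 by rewrite subr_lt0.
by case: (_ - _).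
Qed.

HB.instance Definition _ := GRing.isZmodMorphism.Build _ _ laurent_of_poly
  laurent_of_poly_is_zmod_morphism.
HB.instance Definition _ := GRing.isMonoidMorphism.Build _ _ laurent_of_poly
  laurent_of_poly_is_monoid_morphism.

End LaurentField.

(* The valuation [v]; only meaningful for [x != 0], since [v 0] is infinite. *)
Definition lval (F : fieldType) (x : laurent F) : int := - ldeg x.

Definition labs (R : realType) (F : finFieldType) (x : laurent F) : R :=
  if x == 0 then 0 else #|F|%:R ^ (- lval x).

Section LaurentTopology.
Variable F : fieldType.

(* [y] agrees with [x] in all degrees [>= N] iff [|x - y| < q^N]. *)
Definition laurent_open (U : set (laurent F)) : Prop :=
  forall x, U x ->
    exists N : int, forall y : laurent F, (forall i, N <= i -> y i = x i) -> U y.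

Lemma laurent_openT : laurent_open setT.
Proof. by move=> x _; exists 0. Qed.

Lemma laurent_openI : setI_closed laurent_open.
Proof.
move=> U V hU hV x [/hU[M hM] /hV[N hN]]; exists (Num.min M N) => y hy.
by split; [apply: hM|apply: hN] => i hi; apply: hy; rewrite ge_min hi ?orbT.
Qed.

Lemma laurent_open_bigU (I : Type) (f : I -> set (laurent F)) :
  (forall i, laurent_open (f i)) -> laurent_open (\bigcup_i f i).
Proof.
by move=> hf x [i _ /hf[N hN]]; exists N => y /hN fy; exists i.
Qed.

HB.instance Definition _ := isPointed.Build (laurent F) 0.
HB.instance Definition _ := isOpenTopological.Build (laurent F)
  laurent_openT laurent_openI laurent_open_bigU.

End LaurentTopology.

Section Torus.
Local Open Scope quotient_scope.
Variable F : fieldType.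

Definition poly_part : {pred laurent F} :=
  fun x => `[< exists p : {poly F}, x = laurent_of_poly p >].

Lemma poly_part_zmod_closed : zmod_closed poly_part.
Proof.
split; first by apply/asboolP; exists 0; rewrite raddf0.
move=> x y /asboolP[p ->] /asboolP[q ->].
by apply/asboolP; exists (p - q); rewrite raddfB.
Qed.

HB.instance Definition _ :=
  GRing.isZmodClosed.Build (laurent F) poly_part poly_part_zmod_closed.

(* [F((1/t)) / F[t]] *)
Definition torus : Type := Quotient.quot (poly_part : zmodClosed (laurent F)).

HB.instance Definition _ := Quotient.on torus.
HB.instance Definition _ := GRing.Zmodule.on torus.
HB.instance Definition _ := isPointed.Build torus 0.

(* The quotient topology; [quotient_topology] itself would install a second,
   a priori different, choice structure on the carrier. *)
Definition torus_open (U : set torus) : Prop := open (\pi_torus @^-1` U).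

Lemma torus_openT : torus_open setT.
Proof. by rewrite /torus_open preimage_setT; exact: openT. Qed.

Lemma torus_openI : setI_closed torus_open.
Proof. by move=> U V hU hV; rewrite /torus_open preimage_setI; exact: openI. Qed.

Lemma torus_open_bigU (I : Type) (f : I -> set torus) :
  (forall i, torus_open (f i)) -> torus_open (\bigcup_i f i).
Proof.
by move=> hf; rewrite /torus_open preimage_bigcup; apply: bigcup_open => i _; exact: hf.
Qed.

HB.instance Definition _ := isOpenTopological.Build torus
  torus_openT torus_openI torus_open_bigU.

Lemma frac_subproof (x : laurent F) :
  exists m : int, forall i, m < i -> (if i < 0 then x i else 0) = 0.
Proof. by exists 0 => i /ltW; rewrite leNgt => /negbTE ->. Qed.

Definition frac (x : laurent F) : laurent F := Laurent (frac_subproof x).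

(* The preimage of [a] whose terms all have negative degree. *)
Definition torus_lift (a : torus) : laurent F := frac (repr a).

Lemma torus_eqP (x y : laurent F) :
  (\pi_torus x = \pi_torus y) <-> (exists p, x - y = laurent_of_poly p).
Proof.
split=> [/eqP|[p xy]]; last apply/eqP; rewrite -Quotient.idealrBE.
  by move=> /asboolP.
by apply/asboolP; exists p.
Qed.

Lemma sub_frac_poly (x : laurent F) : exists p, x - frac x = laurent_of_poly p.
Proof.
have [m hm] := lbound_ex x; exists (\poly_(j < `|m|%N.+1) x j%:Z).
apply: laurentP => i; rewrite lcoefB /=.
case: i => [n|n] /=; last by rewrite subrr.
rewrite subr0 coef_poly; case: ltnP => // mn; apply: hm.
by rewrite (le_lt_trans (ler_norm m))// -abszE ltz_nat.
Qed.

Lemma torus_liftK (a : torus) : \pi_torus (torus_lift a) = a.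
Proof.
rewrite -[RHS]reprK; apply/esym/torus_eqP; exact: sub_frac_poly.
Qed.

Lemma torus_lift_neg (a : torus) i : 0 <= i -> torus_lift a i = 0.
Proof. by rewrite /torus_lift /= leNgt => /negbTE ->. Qed.

Lemma torus_lift_uniq (a : torus) (x : laurent F) :
  \pi_torus x = a -> (forall i, 0 <= i -> x i = 0) -> x = torus_lift a.
Proof.
rewrite -{1}(torus_liftK a) => /torus_eqP[p xp] hx; apply/eqP.
rewrite -subr_eq0 xp; apply/eqP/laurentP => -[n|n]//.
by rewrite -xp lcoefB hx// torus_lift_neg// subrr.
Qed.

End Torus.

Definition borel_torus (F : fieldType) := g_sigma_algebraType (@open (torus F)).

Section TorusMap.
Local Open Scope quotient_scope.
Variables (F : fieldType) (d : nat).

Definition torus_proj (x : 'cV[laurent F]_d) : d.-tuple (torus F) :=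
  [tuple \pi_(torus F) (x i 0) | i < d].

(* The map induced on [(F((1/t)) / F[t])^d] by [x |-> A x]; by
   [torus_mulmx_proj] it does not depend on the chosen preimage. *)
Definition torus_mulmx (A : 'M[{poly F}]_d) (a : d.-tuple (torus F)) :
    d.-tuple (torus F) :=
  torus_proj (map_mx (@laurent_of_poly F) A *m \col_j torus_lift (tnth a j)).

Lemma torus_mulmx_proj (A : 'M[{poly F}]_d) (x : 'cV[laurent F]_d) :
  torus_mulmx A (torus_proj x) =
  torus_proj (map_mx (@laurent_of_poly F) A *m x).
Proof.
apply: eq_from_tnth => i; rewrite !tnth_mktuple; apply/torus_eqP.
have hp j : exists p : {poly F},
    torus_lift (tnth (torus_proj x) j) - x j 0 = laurent_of_poly p.
  by apply/torus_eqP; rewrite torus_liftK tnth_mktuple.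
exists (\sum_j A i j * projT1 (cid (hp j))).
rewrite rmorph_sum !mxE -sumrB; apply: eq_bigr => j _.
by case: (cid (hp j)) => p hpj; rewrite !mxE rmorphM /= -hpj mulrBr.
Qed.

End TorusMap.

Definition torus_dist (R : realType) (F : finFieldType) (d : nat)
    (a b : d.-tuple (torus F)) : R :=
  \big[Num.max/0]_(i < d) labs R (torus_lift (tnth a i) - torus_lift (tnth b i)).

(* [mu] is a probability measure, so translation invariance makes it the
   normalized Haar measure. *)
Definition is_haar (R : realType) (F : fieldType)
    (mu : probability (borel_torus F) R) : Prop :=
  forall (a : torus F) (E : set (borel_torus F)), measurable E ->
    mu [set a + x | x in (E : set (torus F))] = mu E.

Section ProductMeasure.
Local Open Scope ereal_scope.
Context {disp : measure_display} {T : measurableType disp} {R : realType}.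
Variable mu : probability T R.

Definition tuple_cons (n : nat) (x : T * n.-tuple T) : n.+1.-tuple T :=
  [the n.+1.-tuple T of x.1 :: x.2].

Lemma measurable_tuple_cons n : measurable_fun setT (@tuple_cons n).
Proof. exact: measurable_cons measurable_fst measurable_snd. Qed.

HB.instance Definition _ n := isMeasurableFun.Build _ _ _ _ (@tuple_cons n)
  (@measurable_tuple_cons n).

Fixpoint prod_measure (n : nat) : probability (n.-tuple T) R :=
  match n with
  | 0 => dirac [tuple]
  | n'.+1 => distribution (mu \x prod_measure n') (@tuple_cons n')
  end.

Lemma prod_measure_box n (E : 'I_n -> set T) : (forall i, measurable (E i)) ->
  prod_measure n [set x | forall i, E i (tnth x i)] = \prod_(i < n) mu (E i).
Proof.
elim: n E => [|n IH] E mE.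
  by rewrite big_ord0 /= diracE mem_set// => -[].
rewrite big_ord_recl /= /distribution /pushforward.
rewrite (_ : _ @^-1` _ =
  E ord0 `*` [set x | forall i, E (lift ord0 i) (tnth x i)]).
  rewrite product_measure1E//.
    by congr (_ * _); exact: (IH (fun i => E (lift ord0 i))).
  rewrite (_ : [set _ | _] =
      \bigcap_(i in [set: 'I_n]) ((fun x => tnth x i) @^-1` E (lift ord0 i))).
    apply: fin_bigcap_measurable => // i _; rewrite -[X in measurable X]setTI.
    exact: measurable_tnth.
  by apply/seteqP; split=> [x hx i _|x hx i]; [exact: (hx i)|exact: (hx i I)].
apply/seteqP; split=> -[x y] /=.
  move=> h; split; first exact: (h ord0).
  by move=> i; have := h (lift ord0 i); rewrite tnthS.
move=> [hx hy] i; case: (unliftP ord0 i) => [j|] -> //.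
by rewrite tnthS; exact: hy.
Qed.

End ProductMeasure.

Section MeasureEntropy.
Context {disp : measure_display} {T : measurableType disp} {R : realType}.
Variables (P : probability T R) (f : T -> T).

Definition measurable_partition (k : nat) (xi : 'I_k -> set T) : Prop :=
  [/\ forall i, measurable (xi i), trivIset setT xi & \bigcup_i xi i = setT].

(* [ln 0 = 0], so null sets contribute [0]. *)
Definition shannon_entropy (I : finType) (xi : I -> set T) : R :=
  - \sum_(i : I) fine (P (xi i)) * ln (fine (P (xi i))).

(* The join of the partitions [f^-j xi], [j < n]. *)
Definition join_partition (k : nat) (xi : 'I_k -> set T) (n : nat)
    (w : {ffun 'I_n -> 'I_k}) : set T :=
  \bigcap_(j in [set: 'I_n]) (iter j f @^-1` xi (w j)).

Definition partition_entropy (k : nat) (xi : 'I_k -> set T) : R :=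
  limn (fun n => shannon_entropy (@join_partition k xi n) / n%:R).

Definition measure_entropy : \bar R :=
  ereal_sup [set h | exists k (xi : 'I_k -> set T),
    measurable_partition xi /\ h = (partition_entropy xi)%:E].

End MeasureEntropy.

Section TopologicalEntropy.
Context {X : eqType} {R : realType}.
Variables (dist : X -> X -> R) (f : X -> X).

Definition bowen_dist (n : nat) (x y : X) : R :=
  \big[Num.max/0]_(k < n) dist (iter k f x) (iter k f y).

Definition separated (n : nat) (e : R) (s : seq X) : Prop :=
  uniq s /\ {in s &, forall x y, x != y -> e < bowen_dist n x y}.

Definition max_separated (n : nat) (e : R) : \bar R :=
  ereal_sup [set (size s)%:R%:E | s in separated n e].

(* Bowen's definition: the limit as [e] decreases to [0] of the exponential
   growth rate of the largest [(n, e)]-separated sets. *)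
Definition separated_growth (e : R) : \bar R :=
  limn_esup (fun n => (n%:R^-1)%:E * lne (max_separated n e))%E.

Definition topological_entropy : \bar R :=
  lim (separated_growth e @[e --> 0^'+]).

End TopologicalEntropy.

Definition is_algebraic_closure (L : fieldType) (K : closedFieldType)
    (iota : {rmorphism L -> K}) : Prop :=
  forall z : K, algebraicOver iota z.

Definition is_absolute_value (R : realType) (K : fieldType) (a : K -> R) : Prop :=
  [/\ forall z, 0 <= a z,
      forall z, a z = 0 <-> z = 0,
      forall z w, a (z * w) = a z * a w
    & forall z w, a (z + w) <= a z + a w].

(* Main.v *)
(* Write [q] for the cardinality of [F] and [O = F[[1/t]]]. The set of points of
   the torus whose first [N] digits vanish along the first [n] steps of the orbit
   is an open subgroup [D]. The [n]-th join of the partition into cylinders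
   of depth [N] consists of translates of [D], so its entropy is [- ln (mu D)], and
   [1 / mu D] is also the largest size of an [(n, e)]-separated set when
   [q^-(N+1) <= e < q^-N].
   For large [N] a point of [D] lifts to a small vector [x] with [A^j x] small for
   all [j < n]. Choose among the rows of [1, A, ..., A^(n-1)] a [d x d] block [B]
   with [|det B|] maximal: by Cramer's rule all the other rows are [O]-linear
   combinations of those of [B], so [D] is the set of [x] with [B x] small and
   [mu D = q^(-dN) / |det B|].
   The maximal minor changes by at most a bounded factor when [A] is conjugated
   over the closure of [F((1/t))]. For a lower triangular conjugate with
   [|lambda_1| >= ... >= |lambda_d|] and small entries below the diagonal it is
   exactly the product of the [max(|lambda_i|, 1)^(n-1)]. This gives the growth
   rate for every large [N].
   An arbitrary finite partition is guessed with small error from a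
   cylinder partition, and Gibbs' inequality bounds its entropy rate by that of the
   cylinders plus an error tending to [0]. *)

Require Import Defs.
From HB Require Import structures.
From mathcomp Require Import all_boot all_order all_algebra.
From mathcomp Require Import all_classical all_reals all_analysis.
From mathcomp Require Import perm finfield ring lra zify.
Import Order.TTheory GRing.Theory Num.Theory.
Import numFieldNormedType.Exports.

Set Implicit Arguments.
Unset Strict Implicit.
Unset Printing Implicit Defensive.

Local Open Scope classical_set_scope.
Local Open Scope ring_scope.

Local Notation lbound := Defs.lbound.
Local Notation frac := Defs.frac.

(** * Absolute values and minors *)

Section AbsoluteValue.
Variables (R : realType) (K : fieldType) (a : K -> R).
Hypothesis ha : is_absolute_value a.

Lemma absv_ge0 x : 0 <= a x. Proof. by case: ha. Qed.

Lemma absvM x y : a (x * y) = a x * a y. Proof. by case: ha. Qed.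

Lemma absv0 : a 0 = 0. Proof. by case: ha => _ /(_ 0) [_ ->]. Qed.

Lemma absv_eq0 x : (a x == 0) = (x == 0).
Proof. by apply/eqP/eqP => [|->]; [case: ha => _ /(_ x) []|exact: absv0]. Qed.

Lemma absv1 : a 1 = 1.
Proof.
have a1 : a 1 != 0 by rewrite absv_eq0 oner_neq0.
by apply: (mulfI a1); rewrite -absvM !mulr1.
Qed.

Lemma absvX x n : a (x ^+ n) = a x ^+ n.
Proof. by elim: n => [|n IH]; rewrite ?expr0 ?absv1// !exprS absvM IH. Qed.

Lemma absvN1 : a (-1) = 1.
Proof.
apply/eqP; rewrite -(@eqrXn2 _ 2) ?absv_ge0// -absvX sqrrN !expr1n.
by rewrite absv1.
Qed.

Lemma absvV x : a x^-1 = (a x)^-1.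
Proof.
have [->|x0] := eqVneq x 0; first by rewrite invr0 absv0 invr0.
have ax : a x != 0 by rewrite absv_eq0.
by apply: (mulfI ax); rewrite -absvM !divff// absv1.
Qed.

Lemma absv_prod (I : Type) (r : seq I) (P : pred I) (f : I -> K) :
  a (\prod_(i <- r | P i) f i) = \prod_(i <- r | P i) a (f i).
Proof. by rewrite (big_morph a absvM absv1). Qed.

Lemma absv_sign (b : bool) : a ((-1) ^+ b) = 1.
Proof. by rewrite absvX absvN1 expr1n. Qed.

(* Comparing [|x + y|^k] with [|x|^k + |y|^k] for [k] a large power of the
   characteristic. *)
Lemma absv_ultra (p : nat) : p \in [pchar K] ->
  forall x y, a (x + y) <= Num.max (a x) (a y).
Proof.
move=> pK x y; rewrite leNgt; apply/negP; set m := Num.max _ _ => ms.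
have m0 : 0 <= m by rewrite le_max absv_ge0.
have [m00|mn0] := eqVneq m 0.
  have /eqP x0 : x == 0.
    by rewrite -absv_eq0 eq_le absv_ge0 andbT -m00 le_max lexx.
  have /eqP y0 : y == 0.
    by rewrite -absv_eq0 eq_le absv_ge0 andbT -m00 le_max lexx orbT.
  by move: ms; rewrite m00 x0 y0 addr0 absv0 ltxx.
have mp : 0 < m by rewrite lt_def mn0.
pose r := a (x + y) / m.
have r1 : 1 < r by rewrite ltr_pdivlMr// mul1r.
have rk n : r ^+ (p ^ n) <= 2.
  rewrite expr_div_n ler_pdivrMr ?exprn_gt0// -absvX exprDn_pchar; last first.
    by rewrite pnatX (pnatE _ (pcharf_prime pK)) pK.
  case: ha => _ _ _ /(_ (x ^+ (p ^ n)) (y ^+ (p ^ n)))/le_trans; apply.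
  rewrite !absvX mulr_natl mulr2n lerD// lerXn2r ?nnegrE ?absv_ge0//.
    by rewrite le_max lexx.
  by rewrite le_max lexx orbT.
(* Bernoulli: a ratio above 1 has unbounded powers, against the uniform bound 2 for the exponents
   [p ^ n]. *)
have bern n : 1 + n%:R * (r - 1) <= r ^+ n.
  elim: n => [|n IH]; first by rewrite mul0r addr0.
  rewrite exprS; have r0 : 0 <= r by rewrite (le_trans _ (ltW r1)).
  apply: le_trans (ler_wpM2l r0 IH); rewrite -subr_ge0.
  rewrite [X in 0 <= X](_ : _ = n%:R * (r - 1) ^+ 2); first by rewrite mulr_ge0// sqr_ge0.
  by rewrite -natr1; ring.
have [n hn] : exists n : nat, (r - 1)^-1 < n%:R.
  by exists (Num.bound (r - 1)^-1); apply: archi_boundP; rewrite invr_ge0 subr_ge0 ltW.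
have nr : 1 < n%:R * (r - 1).
  by rewrite -ltr_pdivrMr ?subr_gt0// div1r.
have : 1 + (p ^ n)%:R * (r - 1) <= 2 by apply: le_trans (bern _) (rk _).
apply/negP; rewrite -ltNge (_ : 2 = 1 + 1)// ltrD2l (lt_le_trans nr)//.
apply: ler_wpM2r; first by rewrite subr_ge0 ltW.
by rewrite ler_nat ltnW// ltn_expl// (prime_gt1 (pcharf_prime pK)).
Qed.

End AbsoluteValue.

Section Ultrametric.
Variables (R : realType) (K : fieldType) (a : K -> R).
Hypothesis ha : is_absolute_value a.
Hypothesis ultra : forall x y, a (x + y) <= Num.max (a x) (a y).

Lemma ultra_sum (I : Type) (r : seq I) (P : pred I) (f : I -> K) (b : R) :
  0 <= b -> (forall i, P i -> a (f i) <= b) -> a (\sum_(i <- r | P i) f i) <= b.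
Proof.
move=> b0 fb; elim/big_rec: _ => [|i x Pi xb]; first by rewrite (absv0 ha).
by apply: le_trans (ultra _ _) _; rewrite ge_max fb.
Qed.

(** Every term of the Leibniz expansion takes one entry from each column, so the column bounds
    multiply with no factorial in front. *)
Lemma ultra_det d (X : 'M[K]_d) (b : 'I_d -> R) :
  (forall i j, a (X i j) <= b j) -> a (\det X) <= \prod_j b j.
Proof.
move=> Xb; have b0 j : 0 <= b j.
  by apply: le_trans (Xb j j); rewrite (absv_ge0 ha).
apply: ultra_sum => [|s _]; first exact: prodr_ge0.
rewrite (absvM ha) (absv_sign ha) mul1r (absv_prod ha).
rewrite [leRHS](reindex_inj (@perm_inj _ s))/=.
by apply: ler_prod => i _; rewrite (absv_ge0 ha) Xb.
Qed.

End Ultrametric.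

(** * Minors of the stacked powers of a matrix *)

Section PowerRows.
Variables (K : comNzRingType) (d : nat).
Implicit Types (X : 'M[K]_d) (n : nat).

(* A square block of the tall matrix with blocks [1, X, ..., X^(n-1)]. *)
Definition power_rows n X (phi : {ffun 'I_d -> 'I_n * 'I_d}) : 'M[K]_d :=
  \matrix_(i, l) (X ^+ (phi i).1) (phi i).2 l.

(* Cauchy-Binet in multilinear form: [power_rows (P X Q)] is a matrix of linear
   combinations of rows of powers of [X], with coefficients independent of [n],
   times [Q]. *)
Lemma det_power_rows_conj n (X P Q : 'M[K]_d) (phi : {ffun 'I_d -> 'I_n * 'I_d}) :
  Q *m P = 1%:M ->
  \det (power_rows (P *m X *m Q) phi) =
  (\sum_(f : {ffun 'I_d -> 'I_d}) (\prod_i P (phi i).2 (f i)) *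
     \det (power_rows X [ffun i => ((phi i).1, f i)])) * \det Q.
Proof.
move=> QP; have powE j : (P *m X *m Q) ^+ j = P *m X ^+ j *m Q.
  elim: j => [|j IH]; first by rewrite !expr0 mulmx1; rewrite (mulmx1C QP).
  rewrite exprS IH -[LHS]/(_ *m _) !mulmxA -(mulmxA _ Q P) QP mulmx1.
  by rewrite exprS -!mulmxA.
rewrite (_ : power_rows _ phi = (\matrix_(i, l) (\sum_k P (phi i).2 k *
    (X ^+ (phi i).1) k l)) *m Q); last first.
  apply/matrixP => i l; rewrite !mxE powE !mxE; apply: eq_bigr => k _.
  by rewrite !mxE.
rewrite det_mulmx; congr (_ * _).
rewrite /determinant; under eq_bigr => s _.
  under eq_bigr do rewrite mxE.
  rewrite bigA_distr_bigA big_distrr /=; over.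
rewrite exchange_big /=; apply: eq_bigr => f _; rewrite big_distrr /=.
apply: eq_bigr => s _; rewrite mulrCA; congr (_ * _).
by rewrite -big_split /=; apply: eq_bigr => i _; rewrite !mxE ffunE.
Qed.

End PowerRows.

Lemma char_poly_conj (K : fieldType) d (P X : 'M[K]_d) : P \in unitmx ->
  char_poly (P *m X *m invmx P) = char_poly X.
Proof.
move=> Pu; rewrite /char_poly; set p := map_mx polyC P.
have -> : char_poly_mx (P *m X *m invmx P) =
    p *m char_poly_mx X *m map_mx polyC (invmx P).
  rewrite /char_poly_mx mulmxBr mulmxBl !map_mxM /=; congr (_ - _).
  by rewrite mul_mx_scalar -scalemxAl -map_mxM mulmxV// map_mx1 scalemx1.
rewrite !det_mulmx mulrAC -det_mulmx -map_mxM mulmxV// map_mx1 det1.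
by rewrite mul1r.
Qed.

Section Triangularization.
Variables (R : realType) (K : fieldType) (a : K -> R).
Hypothesis ha : is_absolute_value a.
Hypothesis unbounded : forall B : R, exists2 t : K, t != 0 & B <= a t.

(* Scaling each new basis vector makes the entries below the diagonal small. *)
Lemma triangular_form d (X : 'M[K]_d) (s : seq K) :
  char_poly X = \prod_(z <- s) ('X - z%:P) ->
  exists2 P, P \in unitmx & let J := P *m X *m invmx P in
    [/\ is_trig_mx J, forall i : 'I_d, J i i = s`_i &
        forall i j : 'I_d, (j < i)%N -> a (J i j) <= 1].
Proof.
elim: d X s => [|d IH] X s Xs.
  exists 1%:M; first exact: unitmx1.
  by split=> [|[]|[]]//; apply/is_trig_mxP => -[].
have : size s = d.+1.
  move/(congr1 (fun p : {poly K} => size p)): Xs.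
  by rewrite size_char_poly size_prod_XsubC => -[].
case: s Xs => // z s Xs [ss].
(* A left eigenvector is completed to a basis as its first row, so the first row of the conjugate
   [Y] is [z] times the first unit row. *)
have /eigenvalueP[v vX v0] : eigenvalue X z.
  by rewrite eigenvalue_root_char Xs big_cons rootM root_XsubC eqxx.
pose e0 : 'rV[K]_d.+1 := delta_mx 0 0.
have [g gu eg] : {g : 'M[K]_d.+1 | g \in unitmx & e0 *m (e0^T *m v) = e0 *m g}.
  apply: complete_unitmx; rewrite mulmxA trmx_delta mul_delta_mx.
  by rewrite (_ : delta_mx _ _ = 1%:M) ?mul1mx ?rank_rV ?v0 -?mxrank_eq0 ?mxrank_delta//;
    apply/matrixP => i j; rewrite !mxE !ord1.
have {}eg : e0 *m g = v.
  rewrite -eg mulmxA trmx_delta mul_delta_mx (_ : delta_mx _ _ = 1%:M) ?mul1mx//.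
  by apply/matrixP => i j; rewrite !mxE !ord1.
have [Y YX] : {Y : 'M[K]_(1 + d) | Y = g *m X *m invmx g} by eexists.
have Yr : e0 *m Y = z *: e0.
  by rewrite YX !mulmxA eg vX -scalemxAl -eg mulmxK.
have Y0 (i j : 'I_(1 + d)) : val i = 0%N -> Y i j = z * (val j == 0%N)%:R.
  move=> i0; have -> : i = 0 by apply: val_inj.
  have := congr1 (fun M : 'rV[K]_d.+1 => M 0 j) Yr; rewrite -rowE !mxE => ->.
  by rewrite eqxx.
have Yul : ulsubmx Y = z%:M.
  by apply/matrixP => i j; rewrite !mxE !ord1 Y0// eqxx mulr1 mulr1n.
have Yur : ursubmx Y = 0.
  by apply/matrixP => i j; rewrite !mxE !ord1 Y0// mulr0.
pose Y' := drsubmx Y; pose c := dlsubmx Y.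
have YE : Y = block_mx z%:M 0 c Y' by rewrite -Yul -Yur submxK.
have Y's : char_poly Y' = \prod_(z <- s) ('X - z%:P).
  have : @char_poly K (1 + d) Y = ('X - z%:P) * \prod_(z <- s) ('X - z%:P).
    by rewrite YX char_poly_conj// Xs big_cons.
  rewrite YE /char_poly /char_poly_mx map_block_mx map_mx0 scalar_mx_block.
  rewrite opp_block_mx add_block_mx subr0 det_lblock => eqp.
  have XS : 'X - z%:P != 0 by rewrite polyXsubC_eq0.
  apply: (mulfI XS); rewrite -eqp; congr (_ * _).
  by rewrite map_scalar_mx -raddfB det_scalar expr1.
have [Q Qu [Qt Qd Qo]] := IH _ _ Y's.
set J' := Q *m _ *m _ in Qt Qd Qo.
(* Conjugation by [P] divides the column below [z] by [t], so a [t] of absolute value at least [B]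
   brings that column down to 1. *)
pose B := \big[Num.max/0]_(i < d) a ((Q *m c) i 0).
have [t t0 Bt] := unbounded B.
pose P : 'M[K]_(1 + d) := block_mx t%:M 0 0 Q.
pose P' : 'M[K]_(1 + d) := block_mx t^-1%:M 0 0 (invmx Q).
have PP' : P *m P' = 1%:M.
  rewrite mulmx_block !mulmx0 !mul0mx !addr0 !add0r mulmxV// -scalar_mxM divff//.
  by rewrite -scalar_mx_block.
have Pu : P \in unitmx by case: (mulmx1_unit PP').
have Pgu : (P *m g : 'M[K]_d.+1) \in unitmx by rewrite unitmx_mul Pu.
have iPg : invmx (P *m g) = invmx g *m P'.
  have PgP : (P *m g) *m (invmx g *m P') = 1%:M.
    by rewrite mulmxA -(mulmxA P) mulmxV// mulmx1 PP'.
  by rewrite -[RHS]mul1mx -(mulVmx Pgu) -mulmxA PgP mulmx1.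
have JE : P *m g *m X *m invmx (P *m g) = block_mx z%:M 0 (t^-1 *: (Q *m c)) J'.
  have -> : P *m g *m X *m invmx (P *m g) = P *m Y *m P'.
    by rewrite iPg YX !mulmxA.
  rewrite YE !mulmx_block.
  rewrite !(mulmx0, mul0mx, addr0, add0r) -!scalar_mxM mulrAC divff// mul1r.
  by rewrite mul_mx_scalar.
have hM (M : 'M[K]_(1 + d)) : M = block_mx z%:M 0 (t^-1 *: (Q *m c)) J' ->
    [/\ is_trig_mx M, forall i : 'I_(1 + d), M i i = (z :: s)`_i &
        forall i j : 'I_(1 + d), (j < i)%N -> a (M i j) <= 1]; last first.
  by exists (P *m g) => //; exact: hM JE.
move=> ->; split.
- apply/is_trig_mxP => i j.
  case: (@split_ordP 1 d i) => i' ->; case: (@split_ordP 1 d j) => j' -> ij.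
  + by move: ij; rewrite !ord1 ltnn.
  + by rewrite block_mxEur mxE.
  + by move: ij; rewrite /= ltnNge ltnW// ltn_addr// ltn_ord.
  + rewrite block_mxEdr; apply: (is_trig_mxP Qt); by move: ij; rewrite /= ltn_add2l.
- move=> i; case: (@split_ordP 1 d i) => i' ->.
    by rewrite block_mxEul !ord1 mxE eqxx.
  by rewrite block_mxEdr Qd /=.
- move=> i j; case: (@split_ordP 1 d i) => i' ->; case: (@split_ordP 1 d j) => j' -> ij.
  + by move: ij; rewrite !ord1 ltnn.
  + by rewrite block_mxEur mxE (absv0 ha).
  + rewrite block_mxEdl mxE (absvM ha) (absvV ha) ler_pdivrMl ?mulr1; last first.
      by rewrite lt_def (absv_eq0 ha) t0 (absv_ge0 ha).
    by apply: le_trans Bt; rewrite ord1; exact: (le_bigmax_cond _ (fun i => a ((Q *m c) i 0))).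
  + by rewrite block_mxEdr; apply: Qo; move: ij; rewrite /= ltn_add2l.
Qed.

End Triangularization.

Section PowerRowsGrowth.
Variables (R : realType) (K : fieldType) (a : K -> R).
Hypothesis ha : is_absolute_value a.
Hypothesis ultra : forall x y, a (x + y) <= Num.max (a x) (a y).

(** The weights in the expansion of [det_power_rows_conj] are products of [d] entries of [P], and an
    ultrametric sum over [f] costs no factor; hence [C] does not depend on [n]. *)
Lemma det_power_rows_conj_le d (X P Q : 'M[K]_d) : Q *m P = 1%:M ->
  exists2 C : R, 0 < C & forall n (M : R),
    (forall phi, a (\det (@power_rows _ _ n X phi)) <= M) ->
    forall phi, a (\det (@power_rows _ _ n (P *m X *m Q) phi)) <= C * M.
Proof.
move=> QP; pose B := \big[Num.max/1]_(ij : 'I_d * 'I_d) a (P ij.1 ij.2).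
have B1 : 1 <= B by exact: bigmax_ge_id.
have B0 : 0 <= B by apply: le_trans B1.
exists (B ^+ d * (a (\det Q) + 1)).
  rewrite mulr_gt0// ?exprn_gt0 ?(lt_le_trans _ B1)//.
  by rewrite ltr_wpDl// (absv_ge0 ha).
move=> n M hM phi; have M0 : 0 <= M.
  by apply: le_trans (hM phi); rewrite (absv_ge0 ha).
rewrite (det_power_rows_conj _ _ QP) (absvM ha).
apply: (@le_trans _ _ (B ^+ d * M * a (\det Q))); last first.
  rewrite mulrAC ler_wpM2r// ler_wpM2l ?exprn_ge0//.
  by rewrite lerDl.
rewrite ler_wpM2r ?(absv_ge0 ha)//; apply: ultra_sum => //.
  by rewrite mulr_ge0// exprn_ge0.
move=> f _; rewrite (absvM ha) ler_pM ?(absv_ge0 ha)//.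
rewrite (absv_prod ha) -[d in B ^+ d]card_ord -prodr_const.
apply: ler_prod => i _; rewrite (absv_ge0 ha) /=.
exact: (le_bigmax_cond _ (fun ij => a (P ij.1 ij.2)) (j := ((phi i).2, f i))).
Qed.

Variables (d : nat) (J : 'M[K]_d).
Hypothesis Jtrig : is_trig_mx J.
Hypothesis Jdec : forall i j : 'I_d, (i <= j)%N -> a (J j j) <= a (J i i).
Hypothesis Joff : forall i j : 'I_d, (j < i)%N -> a (J i j) <= 1.

Let m (i : 'I_d) := Num.max (a (J i i)) 1.

Let m1 i : 1 <= m i. Proof. by rewrite le_max lexx orbT. Qed.
Let m0 i : 0 <= m i. Proof. exact: le_trans (m1 i). Qed.

Lemma trig_expmx n : is_trig_mx (J ^+ n) /\ forall i, (J ^+ n) i i = J i i ^+ n.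
Proof.
elim: n => [|n [IHt IHd]].
  by rewrite expr0; split=> [|i]; [exact: scalar_mx_is_trig|rewrite mxE eqxx].
rewrite exprS; split.
  apply/is_trig_mxP => i j ij; rewrite mxE big1// => k _.
  have [ik|ki] := ltnP i k; first by rewrite (is_trig_mxP Jtrig)// mul0r.
  by rewrite (is_trig_mxP IHt) ?mulr0// (leq_ltn_trans ki).
move=> i; rewrite mxE (bigD1 i)//= big1 ?addr0 ?IHd ?exprS// => k ki.
have [ik|] := ltnP i k; first by rewrite (is_trig_mxP Jtrig)// mul0r.
rewrite leq_eqVlt => /predU1P[/val_inj ek|kli].
  by rewrite ek eqxx in ki.
by rewrite (is_trig_mxP IHt) ?mulr0.
Qed.

(* With the diagonal sorted decreasingly the bound depends on the column only, and
   each column occurs exactly once in every term of a determinant. *)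
Lemma trig_expmx_le n i j : a ((J ^+ n) i j) <= m j ^+ n.
Proof.
elim: n i j => [|n IH] i j.
  by rewrite expr0 mxE; case: eqP => _ /=; rewrite ?(absv1 ha) ?(absv0 ha).
rewrite [in leLHS]exprS mxE; apply: ultra_sum => //; first exact: exprn_ge0.
move=> k _; have [ik|ki] := ltnP i k.
  by rewrite (is_trig_mxP Jtrig)// mul0r (absv0 ha) exprn_ge0.
have [kj|jk] := ltnP k j.
  have [/is_trig_mxP ht _] := trig_expmx n.
  by rewrite ht// mulr0 (absv0 ha) exprn_ge0.
rewrite (absvM ha) exprS ler_pM ?(absv_ge0 ha)//.
move: ki; rewrite leq_eqVlt => /predU1P[/val_inj ek|/Joff/le_trans]; last exact.
by rewrite -ek /m le_max Jdec// ek.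
Qed.

Lemma det_power_rows_trig_le n (phi : {ffun 'I_d -> 'I_n.+1 * 'I_d}) :
  a (\det (power_rows J phi)) <= \prod_i m i ^+ n.
Proof.
apply: ultra_det => // i j; rewrite mxE; apply: le_trans (trig_expmx_le _ _ _) _.
by rewrite ler_weXn2l// -ltnS ltn_ord.
Qed.

(** Row [i] is taken from [J ^+ n] when its diagonal entry has absolute value at least 1, and from
    the identity otherwise. The block is again lower triangular, with the wanted diagonal. *)
Lemma det_power_rows_trig_eq n :
  exists phi : {ffun 'I_d -> 'I_n.+1 * 'I_d},
    a (\det (power_rows J phi)) = \prod_i m i ^+ n.
Proof.
exists [ffun i => (if 1 <= a (J i i) then ord_max else ord0, i)].
rewrite det_trig; last first.
  apply/is_trig_mxP => i j ij; rewrite mxE ffunE /=.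
  have [/is_trig_mxP -> //] :=
    trig_expmx (if 1 <= a (J i i) then ord_max else ord0 : 'I_n.+1).
rewrite (absv_prod ha); apply: eq_bigr => i _; rewrite mxE ffunE /=.
have [_ ->] := trig_expmx (if 1 <= a (J i i) then ord_max else ord0 : 'I_n.+1).
rewrite (absvX ha) /m; by case: leP => h //=; rewrite expr0 expr1n.
Qed.

End PowerRowsGrowth.

(** Passing to the sorted triangular form and back costs a bounded factor each way, and the largest
    minor of that form is known exactly. [M] is described as an attained upper bound, so that the
    maximum may be chosen over a subfield. *)
Lemma det_power_rows_growth (R : realType) (K : fieldType) (a : K -> R) (p : nat)
    d (X : 'M[K]_d) (lambda : 'I_d -> K) :
  is_absolute_value a -> p \in [pchar K] ->
  (forall B : R, exists2 t : K, t != 0 & B <= a t) ->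
  char_poly X = \prod_(i < d) ('X - (lambda i)%:P) ->
  exists2 C : R, 0 < C & forall n (M : R),
    (forall phi, a (\det (@power_rows _ _ n.+1 X phi)) <= M) ->
    (exists phi, a (\det (@power_rows _ _ n.+1 X phi)) = M) ->
    M <= C * (\prod_i Num.max (a (lambda i)) 1) ^+ n /\
    (\prod_i Num.max (a (lambda i)) 1) ^+ n <= C * M.
Proof.
move=> ha pK unb cX; have ultra := absv_ultra ha pK.
(* Decreasing absolute values, the order that the column bound for powers of a triangular matrix
   requires. *)
pose r : rel K := fun x y => a y <= a x.
have rtot : total r by move=> x y; exact: le_total.
have rtr : transitive r by move=> y x z xy yz; exact: le_trans yz xy.
pose s := sort r [seq lambda i | i <- enum 'I_d].
have ps : perm_eq s [seq lambda i | i <- enum 'I_d] by rewrite perm_sort.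
have ss : size s = d by rewrite size_sort size_map size_enum_ord.
have cXs : char_poly X = \prod_(z <- s) ('X - z%:P).
  by rewrite cX (perm_big _ ps) big_map big_enum.
have [P Pu [Jt Jd Jo]] := triangular_form ha unb cXs.
set J := P *m _ *m _ in Jt Jd Jo.
have Jdec (i j : 'I_d) : (i <= j)%N -> a (J j j) <= a (J i i).
  move=> ij; rewrite !Jd.
  have sr : sorted r s by apply: sort_sorted.
  have rr : reflexive r by move=> x; exact: lexx.
  by apply: (sorted_leq_nth rtr rr 0 sr) => //; rewrite inE ss.
have prodE n : \prod_i Num.max (a (J i i)) 1 ^+ n =
    (\prod_i Num.max (a (lambda i)) 1) ^+ n.
  rewrite prodrXl; congr (_ ^+ n).
  transitivity (\prod_(z <- s) Num.max (a z) 1).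
    rewrite (big_nth 0) ss big_mkord; apply: eq_bigr => i _.
    by rewrite Jd.
  by rewrite (perm_big _ ps) big_map big_enum.
have VP : invmx P *m P = 1%:M by rewrite mulVmx.
have PV : P *m invmx P = 1%:M by rewrite mulmxV.
have XJ : X = invmx P *m J *m P.
  by rewrite /J !mulmxA VP mul1mx -mulmxA VP mulmx1.
have [C C0 hC] := det_power_rows_conj_le ha ultra X VP.
have [D D0 hD] := det_power_rows_conj_le ha ultra J PV.
exists (C + D); first exact: addr_gt0.
move=> n M hM [phi ephi].
have M0 : 0 <= M by rewrite -ephi (absv_ge0 ha).
have up := @det_power_rows_trig_le _ _ _ ha ultra _ _ Jt Jdec Jo n.
have [psi epsi] := @det_power_rows_trig_eq _ _ _ ha _ _ Jt n.
rewrite -(prodE n); split.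
  rewrite -ephi {1}XJ; apply: le_trans (hD _ _ up _) _.
  apply: ler_wpM2r; last by rewrite lerDr ltW.
  by apply: prodr_ge0 => i _; rewrite exprn_ge0// le_max ler01 orbT.
rewrite -epsi; apply: le_trans (hC _ _ hM _) _.
by rewrite ler_wpM2r// lerDl ltW.
Qed.

(** * Degrees in [F((1/t))] *)

Section Degree.
Variable F : fieldType.
Implicit Types (x y : laurent F) (m n : int).

Lemma lboundD m x y : lbound m x -> lbound m y -> lbound m (x + y).
Proof. by move=> hx hy i mi; rewrite lcoefD hx ?hy ?addr0. Qed.

Lemma lboundN m x : lbound m x -> lbound m (- x).
Proof. by move=> hx i mi; rewrite lcoefN hx ?oppr0. Qed.

Lemma lboundB m x y : lbound m x -> lbound m y -> lbound m (x - y).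
Proof. by move=> hx hy; apply: lboundD => //; apply: lboundN. Qed.

Lemma lbound_sum m (I : Type) (r : seq I) (P : pred I) (f : I -> laurent F) :
  (forall i, P i -> lbound m (f i)) -> lbound m (\sum_(i <- r | P i) f i).
Proof. by move=> hf; elim/big_rec: _ => // i x Pi; apply: lboundD; apply: hf. Qed.

Lemma lboundM m n x y : lbound m x -> lbound n y -> lbound (m + n) (x * y).
Proof. exact: lmul_bound. Qed.

Lemma lcoef_lead m n x y : lbound m x -> lbound n y ->
  (x * y) (m + n) = x m * y n.
Proof.
move=> hx hy; have := @lmulE F m n 1 0 x y hx hy isT.
by rewrite coefM big_ord_recl big_ord0 !coef_poly /= !subr0 !addr0.
Qed.

Lemma ldeg_eq m x : x m != 0 -> lbound m x -> ldeg x = m.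
Proof.
move=> xm hm; have x0 : x != 0 by apply: contraNneq xm => ->; rewrite lcoef0.
have [xd hd] := ldegP x0; apply/eqP; rewrite eq_le; apply/andP; split.
  by rewrite leNgt; apply: contra xd => /hm ->.
by rewrite leNgt; apply: contra xm => /hd ->.
Qed.

Lemma lbound_ldeg m x : x != 0 -> lbound m x <-> ldeg x <= m.
Proof.
move=> x0; have [xd hd] := ldegP x0; split=> [hm|h]; last exact: lboundW hd.
by rewrite leNgt; apply: contra xd => /hm ->.
Qed.

Lemma lbound_bool (b : bool) : lbound 0 (b%:R : laurent F).
Proof. by case: b => // i i0; rewrite lcoef1 gt_eqF. Qed.

Lemma ldegM x y : x != 0 -> y != 0 -> ldeg (x * y) = ldeg x + ldeg y.
Proof.
move=> x0 y0; have [xd hx] := ldegP x0; have [yd hy] := ldegP y0.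
apply: ldeg_eq; last exact: lboundM.
by rewrite lcoef_lead// mulf_neq0.
Qed.

Lemma ldeg1 : ldeg (1 : laurent F) = 0.
Proof.
apply: ldeg_eq; first by rewrite lcoef1 eqxx oner_neq0.
by move=> i i0; rewrite lcoef1 gt_eqF.
Qed.

Lemma ldegV x : x != 0 -> ldeg x^-1 = - ldeg x.
Proof.
move=> x0; apply/eqP; rewrite -subr_eq0 opprK -ldegM ?invr_eq0//.
by rewrite mulVf//; apply/eqP; exact: ldeg1.
Qed.

Lemma lbound_div m x y : y != 0 -> lbound m x -> lbound (m - ldeg y) (x / y).
Proof.
move=> y0 hx; apply: lboundM => //; apply/lbound_ldeg; first by rewrite invr_eq0.
by rewrite ldegV.
Qed.

Lemma ldeg_polyX : ldeg (laurent_of_poly ('X : {poly F})) = 1.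
Proof.
apply: ldeg_eq => [|[[|[|i]]|i]]//=; rewrite coefX ?oner_neq0//.
Qed.

End Degree.

Section LaurentAbs.
Variables (R : realType) (F : finFieldType).
Implicit Types x y : laurent F.
Local Notation labs := (labs R).

Lemma card_field_gt1 : 1 < #|F|%:R :> R.
Proof. by rewrite ltr1n; exact: card_finNzRing_gt1. Qed.

Lemma card_field_gt0 : 0 < #|F|%:R :> R.
Proof. exact: lt_trans ltr01 card_field_gt1. Qed.

Lemma labs0 : labs (0 : laurent F) = 0.
Proof. by rewrite /Defs.labs eqxx. Qed.

Lemma labsE x : x != 0 -> labs x = #|F|%:R ^ ldeg x.
Proof. by rewrite /Defs.labs /lval opprK => /negbTE ->. Qed.

Lemma labs_gt0 x : x != 0 -> 0 < labs x.
Proof. by move=> x0; rewrite labsE// exprz_gt0// card_field_gt0. Qed.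

Lemma labs_le x (m : int) : labs x <= #|F|%:R ^ m <-> lbound m x.
Proof.
have [->|x0] := eqVneq x 0.
  by split=> _; rewrite ?labs0 ?exprz_ge0// ltW ?card_field_gt0.
by rewrite labsE// ler_eXz2l ?card_field_gt1//; apply: iff_sym; apply: lbound_ldeg.
Qed.

Lemma labsM x y : labs (x * y) = labs x * labs y.
Proof.
have [->|x0] := eqVneq x 0; first by rewrite mul0r labs0 mul0r.
have [->|y0] := eqVneq y 0; first by rewrite mulr0 labs0 mulr0.
rewrite !labsE ?mulf_neq0// ldegM// expfzDr//.
by rewrite gt_eqF// card_field_gt0.
Qed.

Lemma labsN x : labs (- x) = labs x.
Proof.
have [->|x0] := eqVneq x 0; first by rewrite oppr0.
rewrite !labsE ?oppr_eq0//; congr (_ ^ _); apply: ldeg_eq.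
  by rewrite lcoefN oppr_eq0; case: (ldegP x0).
by apply: lboundN; case: (ldegP x0).
Qed.

Lemma labs_sign (b : bool) x : labs ((-1) ^+ b * x) = labs x.
Proof. by case: b; rewrite ?expr1 ?expr0 ?mul1r// mulN1r labsN. Qed.

Lemma labs_le_div x y : y != 0 -> labs x <= labs y -> lbound 0 (x / y).
Proof.
move=> y0 xy; apply/labs_le; rewrite expr0z.
have y1 : labs y^-1 = (labs y)^-1.
  rewrite !labsE ?invr_eq0// ldegV// invr_expz//.
by rewrite labsM y1 ler_pdivrMr ?mul1r// labs_gt0.
Qed.

Lemma labs1 : labs (1 : laurent F) = 1.
Proof. by rewrite labsE ?oner_neq0// ldeg1 expr0z. Qed.

End LaurentAbs.

Section VectorBound.
Variable F : fieldType.
Implicit Types (m n : int).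

Definition vbound d m (x : 'cV[laurent F]_d) := forall i, lbound m (x i 0).

Lemma vboundM d e m n (C : 'M[laurent F]_(e, d)) (x : 'cV[laurent F]_d) :
  (forall i j, lbound m (C i j)) -> vbound n x -> vbound (m + n) (C *m x).
Proof.
by move=> hC hx i; rewrite mxE; apply: lbound_sum => j _; apply: lboundM.
Qed.

(* [X x] integral implies [x] integral, i.e. the inverse of [X] is integral. *)
Definition expanding d (X : 'M[laurent F]_d) :=
  forall x : 'cV[laurent F]_d, vbound 0 (X *m x) -> vbound 0 x.

End VectorBound.

(** * Elimination and Cramer's rule with integral coefficients *)

Section Pivot.
Variables (R : realType) (F : finFieldType).
Local Notation labs := (labs R).

(** One step of Gaussian elimination, with a largest entry of the first column as pivot. The
    multipliers then have absolute value at most 1, so the elimination matrix and its inverse are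
    integral and preserve [vbound m]. *)
Lemma pivot d (X : 'M[laurent F]_(1 + d)) (k : 'I_(1 + d)) : X k 0 != 0 ->
  exists (u : laurent F) (r : 'rV[laurent F]_d) (X' : 'M[laurent F]_d),
    [/\ u != 0, labs (\det X) = labs u * labs (\det X') &
      forall m x0 (x' : 'cV[laurent F]_d), vbound m (X *m col_mx x0%:M x') <->
        lbound m (u * x0 + (r *m x') 0 0) /\ vbound m (X' *m x')].
Proof.
move=> Xk; pose k1 : 'I_(1 + d) := [arg max_(i > k) labs (X i 0)]%O.
have k1max i : labs (X i 0) <= labs (X k1 0).
  by rewrite /k1; case: arg_maxP => //= j _; apply.
have Xk1 : X k1 0 != 0.
  apply: contraTneq (k1max k) => ->.
  by rewrite labs0 -ltNge labs_gt0.
pose s : 'S_(1 + d) := tperm 0 k1.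
pose Y := row_perm s X.
have [u uE] : {u | u = X k1 0} by eexists.
pose c : 'cV[laurent F]_d := u^-1 *: dlsubmx Y.
pose X' := drsubmx Y - c *m ursubmx Y.
have Y0 (i : 'I_1) (j : 'I_1) : Y (lshift d i) (lshift d j) = u.
  rewrite uE mxE !ord1; congr (X _ _); last exact: val_inj.
  by rewrite (_ : lshift d 0 = 0) ?tpermL//; apply: val_inj.
have Yul : ulsubmx Y = u%:M.
  by apply/matrixP => i j; rewrite !ord1 [LHS]mxE [LHS]mxE Y0 mxE.
have YE : Y = block_mx u%:M (ursubmx Y) (dlsubmx Y) (drsubmx Y).
  by rewrite -Yul submxK.
have u0 : u != 0 by rewrite uE.
have cO i j : lbound 0 (c i j).
  rewrite mxE mulrC; apply: (@labs_le_div R) => //; rewrite uE mxE mxE.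
  rewrite !ord1 [X in labs X]mxE (_ : lshift d 0 = 0); first exact: k1max.
  exact: val_inj.
pose L : 'M[laurent F]_(1 + d) := block_mx 1%:M 0 (- c) 1%:M.
pose L' : 'M[laurent F]_(1 + d) := block_mx 1%:M 0 c 1%:M.
have L'L : L' *m L = 1%:M.
  rewrite mulmx_block !(mulmx0, mul0mx, addr0, add0r, mul1mx, mulmx1) subrr.
  by rewrite -scalar_mx_block.
have LY : L *m Y = block_mx u%:M (ursubmx Y) 0 X'.
  rewrite [in LHS]YE mulmx_block !(mulmx0, mul0mx, addr0, add0r, mul1mx, mulmx1).
  rewrite mul_mx_scalar scalerN scalerA mulfV// scale1r addNr.
  by rewrite mulNmx addrC.
exists u, (ursubmx Y), X'; split => //.
  have : labs (\det (L *m Y)) = labs u * labs (\det X').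
    by rewrite LY det_ublock det_scalar expr1 labsM.
  rewrite det_mulmx det_lblock !det1 !mul1r => <-.
  by rewrite /Y row_permE det_mulmx det_perm labs_sign.
move=> m x0 x'.
have -> : vbound m (X *m col_mx x0%:M x') <-> vbound m (L *m Y *m col_mx x0%:M x').
  rewrite -mulmxA /Y row_permE -!mulmxA; set y := X *m _.
  have yE i : (perm_mx s *m y) i 0 = y (s i) 0.
    by rewrite -row_permE mxE.
  have -> : vbound m y <-> vbound m (perm_mx s *m y).
    split=> h i; first by rewrite yE.
    by rewrite -[i](permKV s) -yE.
  move: (perm_mx s *m y) => w; split => h.
    rewrite -[m]add0r; apply: vboundM => // i j.
    rewrite /L; case: (split_ordP i) => i' ->; case: (split_ordP j) => j' ->.
    - by rewrite block_mxEul mxE; exact: lbound_bool.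
    - by rewrite block_mxEur mxE.
    - by rewrite block_mxEdl mxE; apply: lboundN.
    - by rewrite block_mxEdr mxE; exact: lbound_bool.
  rewrite -[w]mul1mx -L'L -mulmxA -[m]add0r; apply: vboundM => // i j.
  rewrite /L'; case: (split_ordP i) => i' ->; case: (split_ordP j) => j' ->.
  - by rewrite block_mxEul mxE; exact: lbound_bool.
  - by rewrite block_mxEur mxE.
  - by rewrite block_mxEdl.
  - by rewrite block_mxEdr mxE; exact: lbound_bool.
rewrite LY mul_block_col mul0mx add0r -scalar_mxM; split=> [h|[h1 h2] i].
  split=> [|i]; first by have := h (lshift _ 0); rewrite col_mxEu mxE mxE eqxx.
  by have := h (rshift _ i); rewrite col_mxEd.
case: (split_ordP i) => i' ->; last by rewrite col_mxEd.
by rewrite col_mxEu mxE !ord1 mxE eqxx.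
Qed.

(* Cramer's rule: the coefficients expressing the rows of all powers of [X] in
   terms of the chosen ones are quotients of minors by the largest one. *)
Lemma best_power_rows d n (X : 'M[laurent F]_d) :
  exists phi : {ffun 'I_d -> 'I_n.+1 * 'I_d},
    (forall psi : {ffun 'I_d -> 'I_n.+1 * 'I_d},
       labs (\det (power_rows X psi)) <= labs (\det (power_rows X phi))) /\
    (forall m (x : 'cV[laurent F]_d),
       vbound m (power_rows X phi *m x) <->
       forall j, (j <= n)%N -> vbound m (X ^+ j *m x)).
Proof.
pose phi0 : {ffun 'I_d -> 'I_n.+1 * 'I_d} := [ffun i => (ord0, i)].
pose g (psi : {ffun 'I_d -> 'I_n.+1 * 'I_d}) := labs (\det (power_rows X psi)).
pose phi := [arg max_(psi > phi0) g psi]%O.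
have hmax psi : g psi <= g phi by rewrite /phi; case: arg_maxP => //= f _; apply.
exists phi; split => //; set B := power_rows X phi.
(* The identity is one of the competing blocks, so the maximal minor is nonzero. *)
have B0 : \det B != 0.
  apply: contraTneq (hmax phi0) => hB; rewrite /g -/B hB labs0 -ltNge.
  rewrite (_ : power_rows X phi0 = 1%:M); first by rewrite det1 labs1 ltr01.
  by apply/matrixP => i l; rewrite mxE ffunE /= expr0.
have Bu : B \in unitmx by rewrite unitmxE unitfE.
move=> m x; split=> [h j jn|h i]; last first.
  have := h (phi i).1 (leq_ord _) (phi i).2.
  by rewrite !mxE; congr (lbound m _); apply: eq_bigr => l _; rewrite mxE.
rewrite -[X ^+ j](mulmxKV Bu) -(mulmxA _ B x) -[m]add0r; apply: vboundM => // k l.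
have -> : invmx B = (\det B)^-1 *: \adj B by rewrite /invmx Bu.
rewrite -scalemxAr mxE mulrC.
(* Replacing row [l] of the block leaves the cofactors along that row unchanged. *)
pose psi : {ffun 'I_d -> 'I_n.+1 * 'I_d} :=
  [ffun i => if i == l then (inord j, k) else phi i].
suff -> : (X ^+ j *m \adj B) k l = \det (power_rows X psi).
  by apply: (@labs_le_div R) => //; exact: hmax.
rewrite (expand_det_row _ l) mxE; apply: eq_bigr => i _.
rewrite !mxE ffunE eqxx /= inordK ?ltnS//; congr (_ * _).
rewrite /cofactor; congr (_ * \det _); apply/matrixP => i' j'.
by rewrite !mxE ffunE eq_sym (negbTE (neq_lift _ _)).
Qed.

End Pivot.

(** * Digits and Haar measure *)

Section FiniteFibers.
Context {disp : measure_display} {T : measurableType disp} {R : realType}.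
Variable P : probability T R.

(** Measurability of a map into a discrete set, stated fiberwise so that finite types need no
    sigma-algebra. *)
Definition fibers_measurable (W : Type) (g : T -> W) :=
  forall w, measurable (g @^-1` [set w]).

Lemma fine_prob_ge0 (E : set T) : 0 <= fine (P E).
Proof. by rewrite fine_ge0. Qed.

Lemma fine_probK (E : set T) : measurable E -> (fine (P E))%:E = P E.
Proof. by move=> mE; rewrite fineK// fin_num_measure. Qed.

Lemma fine_prob_le (E E' : set T) : measurable E -> measurable E' ->
  E `<=` E' -> fine (P E) <= fine (P E').
Proof.
move=> mE mE' EE'; rewrite -lee_fin !fine_probK//.
by apply: le_measure => //; rewrite inE.
Qed.

Lemma fine_probT : fine (P setT) = 1.
Proof. by rewrite probability_setT. Qed.

Lemma fibers_preimage (W : finType) (g : T -> W) (S : pred W) :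
  fibers_measurable g -> measurable [set z | S (g z)].
Proof.
move=> mg; rewrite (_ : [set z | S (g z)] =
    \big[setU/set0]_(w | S w) (g @^-1` [set w])); first exact: bigsetU_measurable.
apply/seteqP; split=> z /=.
  by move=> Sgz; rewrite (bigD1 (g z))//=; left.
by elim/big_rec: _ => //= w E Sw IH [->|/IH].
Qed.

Lemma prob_fibers (W : finType) (g : T -> W) (E : set T) :
  fibers_measurable g -> measurable E ->
  fine (P E) = \sum_w fine (P (E `&` g @^-1` [set w])).
Proof.
move=> mg mE; apply: EFin_inj; rewrite fine_probK// -sumEFin.
rewrite [in LHS](_ : E = \bigcup_(w in [set: W]) (E `&` g @^-1` [set w])); last first.
  by apply/seteqP; split=> [z Ez|z [w _ []]//]; exists (g z).
rewrite measure_fin_bigcup//; last 3 first.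
- exact: finite_finset.
- by move=> i j _ _ [z [/= [_ ->] [_ ->]]].
- by move=> w _; exact: measurableI.
rewrite (fsbigE (index_enum W)) ?index_enum_uniq//; last first.
  by move=> w _; rewrite mem_index_enum.
apply: eq_big => [w|w _]; first by rewrite in_setT.
by rewrite fine_probK//; exact: measurableI.
Qed.

Lemma prob_preimage (W : finType) (g : T -> W) (S : pred W) :
  fibers_measurable g ->
  fine (P [set z | S (g z)]) = \sum_(w | S w) fine (P (g @^-1` [set w])).
Proof.
move=> mg; rewrite (prob_fibers mg) ?[RHS]big_mkcond/=; last exact: fibers_preimage.
apply: eq_bigr => w _; case: ifP => Sw.
  by congr (fine (P _)); apply/seteqP; split=> [z []//|z /= gz]; split=> //=; rewrite gz.
rewrite (_ : _ `&` _ = set0) ?measure0//; apply/seteqP; split=> z //= [Sg gz].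
by move: Sw; rewrite -gz Sg.
Qed.

Lemma sum_fibers (W : finType) (g : T -> W) :
  fibers_measurable g -> \sum_w fine (P (g @^-1` [set w])) = 1.
Proof.
move=> mg; rewrite -fine_probT (prob_fibers mg)//.
by apply: eq_bigr => w _; rewrite setTI.
Qed.

End FiniteFibers.

Section TorusCoordinates.
Local Open Scope quotient_scope.
Variables (F : fieldType) (d : nat).
Implicit Types (x y : 'cV[laurent F]_d) (z : d.-tuple (torus F)).

Definition lift_vec z : 'cV[laurent F]_d := \col_j torus_lift (tnth z j).

(** Only negative degrees are read, so adding polynomials changes nothing and this additive map
    descends to the torus. *)
Definition trunc_vec N x : 'M[F]_(d, N) := \matrix_(i, k) x i 0 (Negz k).

Definition trunc N z : 'M[F]_(d, N) := trunc_vec N (lift_vec z).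

Lemma torus_lift_pi (x : laurent F) : torus_lift (\pi_(torus F) x) = frac x.
Proof.
apply/esym/torus_lift_uniq => [|i i0]; last by rewrite /= ltNge i0.
apply/torus_eqP; have [p xp] := sub_frac_poly x; exists (- p).
by rewrite raddfN /= -xp opprB.
Qed.

Lemma lift_vec_proj x i k : lift_vec (torus_proj x) i 0 (Negz k) = x i 0 (Negz k).
Proof. by rewrite mxE tnth_mktuple torus_lift_pi. Qed.

Lemma lift_vec_ge0 z i j k : 0 <= k -> lift_vec z i j k = 0.
Proof. by move=> k0; rewrite mxE torus_lift_neg. Qed.

Lemma lift_vecK z : torus_proj (lift_vec z) = z.
Proof. by apply: eq_from_tnth => i; rewrite tnth_mktuple mxE torus_liftK. Qed.

Lemma trunc_proj N x : trunc N (torus_proj x) = trunc_vec N x.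
Proof. by apply/matrixP => i k; rewrite mxE lift_vec_proj mxE. Qed.

Lemma trunc_vecB N x y : trunc_vec N (x - y) = trunc_vec N x - trunc_vec N y.
Proof. by apply/matrixP => i k; rewrite !mxE. Qed.

(* [Negz N] is [-(N + 1)]: the first [N] digits are those of degree [-1] to [-N]. *)
Lemma vbound_trunc N x : vbound (-1) x ->
  vbound (Negz N) x <-> trunc_vec N x = 0.
Proof.
move=> hx; split=> [h|h i k].
  by apply/matrixP => i k; rewrite !mxE h// !NegzE ltrN2 ltz_nat ltnS.
case: k => k Nk; first by apply: hx.
move: Nk; rewrite !NegzE ltrN2 ltz_nat ltnS => kN.
by have := congr1 (fun M : 'M[F]_(d, N) => M i (Ordinal kN)) h; rewrite !mxE NegzE.
Qed.

Lemma vbound_lift_vec z : vbound (-1) (lift_vec z).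
Proof. by move=> i k k1; apply: lift_vec_ge0; move: k1; case: k => [|[]]. Qed.

Lemma digit_vec_subproof N (w : 'I_N -> F) :
  exists m : int, forall i, m < i ->
    (if i is Negz k then (if insub k is Some k' then w k' else 0) else 0) = 0.
Proof. by exists 0 => -[]. Qed.

(** An additive section of [trunc_vec]; it reduces questions about a point to its first [N]
    digits. *)
Definition digit_vec N (v : 'M[F]_(d, N)) : 'cV[laurent F]_d :=
  \col_i Laurent (digit_vec_subproof (v i)).

Lemma digit_vecK N (v : 'M[F]_(d, N)) : trunc_vec N (digit_vec v) = v.
Proof. by apply/matrixP => i k; rewrite !mxE /= valK. Qed.

Lemma digit_vecB N (v w : 'M[F]_(d, N)) : digit_vec (v - w) = digit_vec v - digit_vec w.
Proof.
apply/matrixP => i j; rewrite !mxE; apply: laurentP => -[k|k]; rewrite lcoefB /= ?subr0//.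
by case: insubP => [k' _ _|_]; rewrite ?mxE ?subr0.
Qed.

Lemma vbound_digit_vec N (v : 'M[F]_(d, N)) : vbound (-1) (digit_vec v).
Proof. by move=> i [k|[|k]]// _; rewrite mxE. Qed.

Lemma vboundB m x y : vbound m x -> vbound m y -> vbound m (x - y).
Proof. by move=> hx hy i; rewrite !mxE; apply: lboundB. Qed.

Lemma vbound_lift_digit_vec N z :
  vbound (Negz N) (lift_vec z - digit_vec (trunc N z)).
Proof.
apply/vbound_trunc; last by rewrite trunc_vecB digit_vecK subrr.
by apply: vboundB; [exact: vbound_lift_vec|exact: vbound_digit_vec].
Qed.

End TorusCoordinates.

Section TorusIterate.
Variables (F : fieldType) (d : nat) (A : 'M[{poly F}]_d).
Implicit Types (z : d.-tuple (torus F)).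

Local Notation AL := (map_mx (@laurent_of_poly F) A).

Lemma iter_torus_mulmx j (x : 'cV[laurent F]_d) :
  iter j (torus_mulmx A) (torus_proj x) = torus_proj (AL ^+ j *m x).
Proof.
elim: j => [|j IH]; first by rewrite expr0 mul1mx.
by rewrite iterS IH torus_mulmx_proj exprS mulmxA.
Qed.

Lemma trunc_iter N j z :
  trunc N (iter j (torus_mulmx A) z) = trunc_vec N (AL ^+ j *m lift_vec z).
Proof. by rewrite -{1}(lift_vecK z) iter_torus_mulmx trunc_proj. Qed.

Lemma torus_mulmx_surj : \det A != 0 -> forall z, exists z', torus_mulmx A z' = z.
Proof.
move=> detA z; have Au : AL \in unitmx.
  rewrite unitmxE unitfE det_map_mx; apply: contra_neq detA => h.
  apply/polyP => i; have := congr1 (fun x : laurent F => x i%:Z) h.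
  by rewrite coef0.
exists (torus_proj (invmx AL *m lift_vec z)).
by rewrite torus_mulmx_proj mulKVmx// lift_vecK.
Qed.

End TorusIterate.

Section TorusDigits.
Local Open Scope quotient_scope.
Variable F : finFieldType.
Implicit Types a b : torus F.

Lemma torus_liftD a b : torus_lift (a + b) = torus_lift a + torus_lift b.
Proof.
apply/esym/torus_lift_uniq => [|i i0]; last by rewrite lcoefD !torus_lift_neg ?addr0.
by rewrite raddfD /= !torus_liftK.
Qed.

Definition digits N a : {ffun 'I_N -> F} := [ffun k : 'I_N => torus_lift a (Negz k)].

Lemma digits_open N w : open (digits N @^-1` [set w]).
Proof.
move=> x /= xw; exists (Negz N) => y hy /=; rewrite -xw; apply/ffunP => k.
rewrite !ffunE !torus_lift_pi /= hy// !NegzE lerN2 lez_nat ltnS ltnW//.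
Qed.

Lemma digits_surj N w : exists a, digits N a = w.
Proof.
pose v : 'M[F]_(1, N) := \row_k w k.
exists (\pi_(torus F) (digit_vec v 0 0)); apply/ffunP => k.
rewrite ffunE torus_lift_pi /=.
by have := congr1 (fun M : 'M[F]_(1, N) => M 0 k) (digit_vecK v); rewrite !mxE.
Qed.

Lemma digitsD N a b : digits N (a + b) = [ffun k => digits N a k + digits N b k].
Proof. by apply/ffunP => k; rewrite !ffunE torus_liftD. Qed.

Lemma borel_open (U : set (torus F)) :
  open U -> measurable (U : set (borel_torus F)).
Proof. by move=> oU; apply: sub_sigma_algebra. Qed.

End TorusDigits.

Section HaarDigits.
Variables (R : realType) (F : finFieldType) (mu : probability (borel_torus F) R).
Hypothesis mu_haar : is_haar mu.
Local Notation q := (#|F|%:R : R).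

Lemma digits_measurable N :
  fibers_measurable (digits N : borel_torus F -> {ffun 'I_N -> F}).
Proof. by move=> w; apply: borel_open; exact: digits_open. Qed.

(** The digit map is a surjective homomorphism, so its [q ^+ N] fibers are translates of one another
    and share the total mass 1 equally. *)
Lemma haar_digits N (w : {ffun 'I_N -> F}) :
  fine (mu (digits N @^-1` [set w])) = (q ^+ N)^-1.
Proof.
have q0 : q ^+ N != 0 by rewrite expf_neq0// gt_eqF// card_field_gt0.
have E v : fine (mu (digits N @^-1` [set v])) = fine (mu (digits N @^-1` [set w])).
  have [a aw] := digits_surj w; have [b bv] := digits_surj v.
  congr fine; rewrite -(mu_haar (b - a) (@digits_measurable N w)).
  congr (mu _); apply/seteqP; split=> [x /= xv|_ [x /= xw <-]].
    exists (x - (b - a)); rewrite /= ?subrKC//.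
    apply/ffunP => k; apply: (addIr (digits N (b - a) k)).
    have /ffunP/(_ k) := digitsD N (x - (b - a)) (b - a); rewrite subrK xv ffunE => <-.
    by have /ffunP/(_ k) := digitsD N (b - a) a; rewrite subrK aw bv ffunE addrC.
  apply/ffunP => k; have /ffunP/(_ k) := digitsD N (b - a) a.
  by rewrite (digitsD N (b - a) x) subrK xw aw bv !ffunE => <-.
have := sum_fibers mu (@digits_measurable N); under eq_bigr do rewrite E.
rewrite sumr_const card_ffun card_ord -[X in X = 1]mulr_natl natrX => e.
by apply: (mulfI q0); rewrite e divff.
Qed.

Variable d : nat.
Local Notation P := (prod_measure mu d).
Local Notation X := (d.-tuple (borel_torus F)).

Lemma trunc_box N (v : 'M[F]_(d, N)) :
  trunc N @^-1` [set v] =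
  [set x : d.-tuple (torus F) | forall i, (digits N @^-1` [set [ffun k => v i k]]) (tnth x i)].
Proof.
apply/seteqP; split=> z /= h => [i|]; first by apply/ffunP => k; rewrite -h !ffunE !mxE.
by apply/matrixP => i k; have /ffunP/(_ k) := h i; rewrite !ffunE !mxE.
Qed.

Lemma trunc_measurable N : fibers_measurable (trunc N : X -> 'M[F]_(d, N)).
Proof.
move=> v; rewrite trunc_box (_ : [set _ | _] = \bigcap_(i in [set: 'I_d])
    ((fun x : X => tnth x i) @^-1` (digits N @^-1` [set [ffun k => v i k]]))).
  apply: fin_bigcap_measurable => // i _; rewrite -[X in measurable X]setTI.
  by apply: measurable_tnth => //; exact: digits_measurable.
by apply/seteqP; split=> [x hx i _|x hx i]; [exact: (hx i)|exact: (hx i I)].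
Qed.

Lemma prob_trunc N (v : 'M[F]_(d, N)) :
  fine (P (trunc N @^-1` [set v])) = (q ^+ (d * N))^-1.
Proof.
pose E (i : 'I_d) : set (borel_torus F) := digits N @^-1` [set [ffun k => v i k]].
have -> : P (trunc N @^-1` [set v]) = (\prod_(i < d) mu (E i))%E.
  rewrite trunc_box; apply: (prod_measure_box mu (E := E)) => i.
  exact: digits_measurable.
rewrite (eq_bigr (fun=> ((q ^+ N)^-1)%:E)); last first.
  move=> i _; rewrite -(haar_digits [ffun k => v i k]) fine_probK//.
  exact: digits_measurable.
by rewrite prodEFin/= prodr_const card_ord exprVn mulnC exprM.
Qed.

Section FiniteQuotient.
Variables (W : zmodType) (h : 'cV[laurent F]_d -> W) (M : nat).
Hypothesis hB : zmod_morphism h.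
Hypothesis hM : forall x, vbound (Negz M) x -> h x = 0.
Local Notation psi := (fun z : X => h (lift_vec z)).

(** A homomorphism killing all vectors of degree below [-M] sees only the first [M] digits, so its
    fibers are finite unions of boxes. *)
Lemma quotient_trunc (z : X) : psi z = h (digit_vec (trunc M z)).
Proof.
by apply/eqP; rewrite -subr_eq0 -hB hM//; exact: vbound_lift_digit_vec.
Qed.

Lemma quotient_fiberE w : psi @^-1` [set w] =
  [set z : X | (fun v => h (digit_vec v) == w) (trunc M z)].
Proof.
apply/seteqP; split=> z /=; rewrite quotient_trunc => /eqP//.
Qed.

Lemma quotient_measurable : fibers_measurable psi.
Proof. by move=> w; rewrite quotient_fiberE;
  exact: (fibers_preimage (fun v => h (digit_vec v) == w) (@trunc_measurable M)). Qed.

(* [psi] is a homomorphism to a discrete group, so its fibers are translates. *)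
Lemma quotient_fiber_eq (z : X) :
  fine (P (psi @^-1` [set psi z])) = fine (P (psi @^-1` [set 0])).
Proof.
have E w : fine (P (psi @^-1` [set w])) =
    \sum_(v | h (digit_vec v) == w) fine (P (trunc M @^-1` [set v])).
  rewrite quotient_fiberE.
  exact: (prob_preimage P (fun v => h (digit_vec v) == w) (@trunc_measurable M)).
rewrite !E.
rewrite (reindex_inj (addIr (trunc M z)))/=; apply: eq_big => [v|v _].
  by rewrite quotient_trunc -[in RHS](addrK (trunc M z) v) digit_vecB hB subr_eq0.
by rewrite !prob_trunc.
Qed.

End FiniteQuotient.

(** Nonempty fibers all have the same mass, and surjectivity makes their number [#|W|]. *)
Lemma quotient_fiber_surj (W : finZmodType) (h : 'cV[laurent F]_d -> W) (M : nat) :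
  zmod_morphism h -> (forall x, vbound (Negz M) x -> h x = 0) ->
  (forall w, exists z : X, h (lift_vec z) = w) ->
  forall w, fine (P ((fun z : X => h (lift_vec z)) @^-1` [set w])) = (#|W|%:R)^-1.
Proof.
move=> hB hM surj w; pose psi (z : X) := h (lift_vec z).
have E v : fine (P (psi @^-1` [set v])) = fine (P (psi @^-1` [set w])).
  by have [z <-] := surj v; have [z' <-] := surj w; rewrite !(quotient_fiber_eq hB hM).
have := sum_fibers P (quotient_measurable hB hM); under eq_bigr do rewrite E.
rewrite sumr_const -[X in X = 1]mulr_natl => e.
have W0 : #|W|%:R != 0 :> R.
  by apply/eqP => W0; move: e; rewrite W0 mul0r => /eqP; rewrite eq_sym oner_eq0.
by apply: (mulfI W0); rewrite e divff.
Qed.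

End HaarDigits.

(** * The measure of a lattice *)

Section Scaling.
Variable F : fieldType.

(** A power of the variable, used for rescaling; the two bounds together force its degree to be
    [k]. *)
Lemma monomial_ex (k : int) : exists t : laurent F,
  [/\ t != 0, lbound k t & lbound (- k) t^-1].
Proof.
pose X := laurent_of_poly ('X : {poly F}).
have X0 : X != 0.
  by apply/eqP => /(congr1 (fun x => lcoef x 1))/eqP; rewrite /= coefX oner_eq0.
have dX (n : nat) : ldeg (X ^+ n) = n%:Z.
  elim: n => [|n IH]; first by rewrite expr0 ldeg1.
  by rewrite exprS ldegM ?expf_neq0// IH ldeg_polyX intS.
have Xn0 n : X ^+ n != 0 by rewrite expf_neq0.
case: k => n; [exists (X ^+ n)|exists (X ^+ n.+1)^-1]; split=> //.
- by apply/lbound_ldeg => //; rewrite dX.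
- by apply/lbound_ldeg; rewrite ?invr_eq0// ldegV// dX.
- by rewrite invr_eq0.
- by apply/lbound_ldeg; rewrite ?invr_eq0// ldegV// dX NegzE.
- by rewrite invrK; apply/lbound_ldeg => //; rewrite dX NegzE opprK.
Qed.

Lemma vboundZ d m n t (x : 'cV[laurent F]_d) :
  lbound m t -> vbound n x -> vbound (m + n) (t *: x).
Proof. by move=> ht hx i; rewrite mxE; apply: lboundM. Qed.

Lemma expandingP d (X : 'M[laurent F]_d) m x :
  expanding X -> vbound m (X *m x) -> vbound m x.
Proof.
move=> eX hx; have [t [t0 ht hV]] := monomial_ex m.
have -> : x = t *: (t^-1 *: x) by rewrite scalerA mulfV// scale1r.
rewrite -[m]addr0; apply: vboundZ => //; apply: eX.
by rewrite -scalemxAr -(addNr m); apply: vboundZ.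
Qed.

Lemma mx_lbound m n (X : 'M[laurent F]_(m, n)) :
  exists b : nat, forall i j, lbound b (X i j).
Proof.
pose b i j := `|projT1 (cid (lbound_ex (X i j)))|%N.
exists (\max_i \max_j b i j)%N => i j.
apply: (@lboundW _ (b i j)); last first.
  rewrite /b; case: cid => k hk /=; apply: lboundW hk.
  by rewrite abszE ler_norm.
rewrite lez_nat; apply: leq_trans (leq_bigmax i) => /=.
exact: (leq_bigmax j).
Qed.

End Scaling.

Section Volume.
Variables (R : realType) (F : finFieldType) (mu : probability (borel_torus F) R).
Hypothesis mu_haar : is_haar mu.
Local Notation q := (#|F|%:R : R).
Local Notation labs := (labs R).

Definition contracted d N (X : 'M[laurent F]_d) : set (d.-tuple (borel_torus F)) :=
  [set z | vbound (Negz N) (X *m lift_vec z)].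

Lemma contracted_measurable d N (X : 'M[laurent F]_d) : measurable (contracted N X).
Proof.
(* [X] raises degrees by at most [b], so digits beyond the first [N + b] only affect degrees below
   [-N]. *)
have [b hb] := mx_lbound X; pose M := (N + b)%N.
rewrite (_ : contracted N X =
  [set z | (fun v => `[< vbound (Negz N) (X *m digit_vec v) >]) (trunc M z)]).
  exact: (fibers_preimage (fun v => `[< vbound (Negz N) (X *m digit_vec v) >])
     (@trunc_measurable F d M)).
have hd z : vbound (Negz N) (X *m lift_vec z - X *m digit_vec (trunc M z)).
  rewrite -mulmxBr (_ : Negz N = b%:Z + Negz M); last by rewrite !NegzE /M; lia.
  by apply: vboundM => //; exact: vbound_lift_digit_vec.
rewrite /contracted; apply/seteqP; split=> [z h|z /asboolP h i].
  apply/asboolP; rewrite -[X *m digit_vec _](subKr (X *m lift_vec z)).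
  exact: vboundB.
  rewrite -[X *m lift_vec z](subrK (X *m digit_vec (trunc M z))) mxE.
by apply: lboundD; [exact: hd|exact: h].
Qed.

(** If the first column vanished, [X] would send the non-integral vector with first entry ['X] and
    all others zero to 0. *)
Lemma expanding_col0 d (X : 'M[laurent F]_(1 + d)) : expanding X ->
  exists k, X k 0 != 0.
Proof.
move=> eX; apply: contrapT => noX.
have X0 : X *m delta_mx 0 0 = 0 :> 'cV_(1 + d).
  apply/matrixP => i j; rewrite -colE !mxE; apply/eqP; apply: contrapT => /negP Xi.
  by apply: noX; exists i.
have h : vbound 0 (laurent_of_poly 'X *: delta_mx 0 0 : 'cV[laurent F]_(1 + d)).
  by apply: eX; rewrite -scalemxAr X0 scaler0 => i; rewrite mxE.
have := h 0 1 isT; rewrite !mxE eqxx mulr1 /= coefX => /eqP.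
by rewrite oner_eq0.
Qed.

Lemma lift_vec_cons d (a : borel_torus F) (z : d.-tuple (borel_torus F)) :
  @lift_vec F (1 + d) (tuple_cons (a, z)) =
  col_mx (torus_lift a)%:M (lift_vec z).
Proof.
apply/matrixP => i j; rewrite ord1; case: (split_ordP i) => k ->.
  by rewrite col_mxEu !mxE !ord1 eqxx; congr torus_lift.
rewrite col_mxEd !mxE; congr torus_lift.
have -> : rshift 1 k = lift ord0 k by apply: val_inj.
by rewrite tnthS.
Qed.

(** A center of negative degree is the standard lift of its class, so the ball is the set of points
    sharing its first [N] digits. *)
Lemma haar_ball N (y : laurent F) : lbound (-1) y ->
  mu [set a : torus F | lbound (Negz N) (torus_lift a - y)] = ((q ^+ N)^-1)%:E.
Proof.
move=> hy; pose w : {ffun 'I_N -> F} := [ffun k : 'I_N => y (Negz k)].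
rewrite -(haar_digits mu_haar w) fine_probK; last exact: digits_measurable.
congr (mu _); apply/seteqP; split=> a /= h.
  apply/ffunP => k; rewrite !ffunE; apply/eqP; rewrite -subr_eq0 -lcoefB h//.
  by rewrite !NegzE ltrN2 ltz_nat ltnS.
case=> k Nk; first by rewrite lcoefB torus_lift_neg// hy// subr0.
move: Nk; rewrite !NegzE ltrN2 ltz_nat ltnS => kN; rewrite -NegzE lcoefB.
by have /ffunP/(_ (Ordinal kN)) := h; rewrite !ffunE /= => ->; rewrite subrr.
Qed.

(* Induction on [d] by Fubini: after pivoting, the slices in the first coordinate are
   balls of one and the same radius. *)
Lemma volume d N (X : 'M[laurent F]_d) : expanding X ->
  fine (prod_measure mu d (contracted N X)) * labs (\det X) = (q ^+ (d * N))^-1.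
Proof.
elim: d X => [|d IH] X eX.
  rewrite det_mx00 labs1 mulr1 mul0n expr0 invr1.
  rewrite (_ : contracted N X = setT) ?probability_setT//.
  by apply/seteqP; split=> // z _ [].
move: X eX; rewrite -[d.+1]/(1 + d)%N => X eX.
have [k Xk] := expanding_col0 eX.
have [u [r [X' [u0 detX hX]]]] := pivot R Xk.
(* Complete [x'] by the first coordinate that annihilates the pivot row, then use that [X] is
   expanding. *)
have eX' : expanding X'.
  move=> x' hx' i.
  have : vbound 0 (X *m col_mx (- u^-1 * (r *m x') 0 0)%:M x').
    apply/hX; split=> //; rewrite mulrA mulrN mulfV// mulN1r addNr//.
  by move=> /eX/(_ (rshift 1 i)); rewrite col_mxEd.
(* [X] sends the vector with first entry [u^-1] and zeros below to an integral one, so [u^-1] is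
   integral and [u] has degree at least 0. *)
have [e ue] : exists e : nat, ldeg u = e.
  have : vbound 0 (X *m col_mx (u^-1)%:M 0).
    apply/hX; rewrite mulfV// !mulmx0 mxE addr0; split=> [i i0|i j _]; last by rewrite mxE.
    by rewrite lcoef1 gt_eqF.
  move=> /eX/(_ (lshift d 0)); rewrite col_mxEu mxE eqxx mulr1n.
  rewrite lbound_ldeg ?invr_eq0// ldegV// oppr_le0.
  by case: (ldeg u) => // e _; exists e.
have u_e : labs u = q ^+ e by rewrite labsE// ue.
pose E' := contracted N X'.
have mE' : measurable E' by exact: contracted_measurable.
(* With the tail [z] fixed in [E'], the pivot row says that the first coordinate lies in a ball
   about [y]; dividing by [u] shrinks its radius by [q ^+ e]. For other tails the slice is empty. *)
have secE z : mu (ysection (@tuple_cons _ (borel_torus F) d @^-1` contracted N X) z) =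
    ((cst ((q ^+ (e + N))^-1)%:E) \_ E') z.
  rewrite /patch; case: ifPn => [/set_mem|/negP] hz.
    pose y := - u^-1 * (r *m lift_vec z) 0 0.
    (* At first coordinate [y] the pivot row vanishes, so the expanding property makes [y] itself
       small; this lets [haar_ball] apply. *)
    have hy : lbound (-1) y.
      have : vbound (Negz N) (X *m col_mx y%:M (lift_vec z)).
        apply/hX; split=> //; rewrite /y mulrA mulrN mulfV// mulN1r addNr//.
      move=> /(expandingP eX)/(_ (lshift d 0)); rewrite col_mxEu mxE eqxx mulr1n.
      by apply: lboundW; rewrite NegzE lerN2 lez_nat.
    rewrite -(haar_ball _ hy); congr (mu _); apply/seteqP; split=> a; rewrite /ysection /=.
      move=> /set_mem; rewrite /contracted /= lift_vec_cons => /hX[+ _].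
      move=> /(lbound_div u0); rewrite mulrDl mulrAC mulfV// mul1r ue.
      rewrite /y mulNr opprK [_ / u]mulrC.
      by rewrite (_ : Negz N - e%:Z = Negz (e + N)); last by rewrite !NegzE; lia.
    move=> ha; apply/mem_set; rewrite /contracted /= lift_vec_cons; apply/hX; split=> //.
    rewrite (_ : _ + _ = u * (torus_lift a - y)); last first.
      by rewrite /y mulrBr mulrA mulrN mulfV// mulN1r opprK.
    rewrite (_ : Negz N = e%:Z + Negz (e + N)); last by rewrite !NegzE; lia.
    by apply: lboundM => //; apply/lbound_ldeg => //; rewrite ue.
  rewrite (_ : ysection _ _ = set0) ?measure0//; apply/seteqP; split=> a //.
  rewrite /ysection /= => /set_mem; rewrite /contracted /= lift_vec_cons => /hX[_ h].
  by apply: hz; apply/mem_set.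
have mE : measurable (@tuple_cons _ (borel_torus F) d @^-1` contracted N X).
  rewrite -[X in measurable X]setTI; apply: measurable_tuple_cons => //.
  exact: contracted_measurable.
(* Slicing with a fixed tail uses the iterated integral in the opposite order to the one in
   [prod_measure]; they agree by uniqueness of the product measure. *)
have -> : prod_measure mu d.+1 (contracted N X) =
    (((q ^+ (e + N))^-1)%:E * prod_measure mu d E')%E.
  transitivity ((mu \x^ prod_measure mu d)%E
      (@tuple_cons _ (borel_torus F) d @^-1` contracted N X)).
    apply: (@product_measure_unique _ _ _ _ _ mu (prod_measure mu d)
      (mu \x^ prod_measure mu d)%E) => //.
    by move=> B C mB mC /=; rewrite product_measure2E.
  rewrite /product_measure2 /=; under eq_integral do rewrite secE.
  by rewrite -integral_mkcond integral_cst.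
rewrite detX u_e fineM//; last exact: fin_num_measure.
have q0 : q != 0 by rewrite gt_eqF// card_field_gt0.
rewrite /= mulrACA (IH X' eX') mulnDl mul1n !exprD !invfM.
by rewrite [_ * q ^+ e]mulrAC mulVf ?expf_neq0// mul1r.
Qed.

End Volume.

(** * Orbit codes *)

Section Cells.
Variables (R : realType) (F : finFieldType) (mu : probability (borel_torus F) R).
Hypothesis mu_haar : is_haar mu.
Variables (d : nat) (A : 'M[{poly F}]_d).
Local Notation q := (#|F|%:R : R).
Local Notation labs := (labs R).
Local Notation AL := (map_mx (@laurent_of_poly F) A).
Local Notation P := (prod_measure mu d).
Local Notation X := (d.-tuple (borel_torus F)).

(** The code read off a lift: an additive map on vectors, to which the results on finite quotients
    apply. *)
Definition orbit_code_vec n N (x : 'cV[laurent F]_d) : {ffun 'I_n -> 'M[F]_(d, N)} :=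
  [ffun j : 'I_n => trunc_vec N (AL ^+ j *m x)].

Definition orbit_code n N (z : X) : {ffun 'I_n -> 'M[F]_(d, N)} :=
  [ffun j : 'I_n => trunc N (iter j (torus_mulmx A) z)].

Lemma orbit_codeE n N (z : X) : orbit_code n N z = orbit_code_vec n N (lift_vec z).
Proof. by apply/ffunP => j; rewrite !ffunE trunc_iter. Qed.

Lemma trunc_vec_small N (x : 'cV[laurent F]_d) : vbound (Negz N) x -> trunc_vec N x = 0.
Proof.
by move=> h; apply/matrixP => i k; rewrite !mxE h// !NegzE ltrN2 ltz_nat ltnS.
Qed.

Lemma orbit_code_vecB n N : zmod_morphism (orbit_code_vec n N).
Proof. by move=> x y; apply/ffunP => j; rewrite !ffunE mulmxBr trunc_vecB. Qed.

Lemma orbit_code_vec_small n N : exists M : nat,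
  forall x, vbound (Negz M) x -> orbit_code_vec n N x = 0.
Proof.
have bj (j : 'I_n) : exists b : nat, forall i k, lbound b ((AL ^+ j) i k).
  exact: mx_lbound.
pose b j := projT1 (cid (bj j)).
exists (N + \max_j b j)%N => x hx; apply/ffunP => j; rewrite !ffunE.
apply: trunc_vec_small.
rewrite (_ : Negz N = (\max_j b j)%N%:Z + Negz (N + \max_j b j)); last first.
  by rewrite !NegzE; lia.
apply: vboundM hx => i k; apply: (@lboundW _ (b j)).
  by rewrite lez_nat; exact: leq_bigmax.
by rewrite /b; case: cid.
Qed.

Lemma orbit_code_measurable n N : fibers_measurable (@orbit_code n N).
Proof.
have [M hM] := orbit_code_vec_small n N.
rewrite (_ : @orbit_code n N = fun z => orbit_code_vec n N (lift_vec z)).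
  by have := quotient_measurable (@orbit_code_vecB n N) hM.
by apply/funext => z; rewrite orbit_codeE.
Qed.

(** The mass of the open subgroup of points with zero code, and by [orbit_code_prob] the mass of
    every nonempty cell. *)
Definition cell_prob n N : R := fine (P (@orbit_code n N @^-1` [set 0])).

Lemma orbit_code_prob n N (z : X) :
  fine (P (@orbit_code n N @^-1` [set orbit_code n N z])) = cell_prob n N.
Proof.
have [M hM] := orbit_code_vec_small n N; rewrite /cell_prob.
rewrite (_ : @orbit_code n N = fun z => orbit_code_vec n N (lift_vec z)).
  by have := quotient_fiber_eq mu_haar (@orbit_code_vecB n N) hM z.
by apply/funext => z'; rewrite orbit_codeE.
Qed.

(** For [b <= N] the zero code means that the lifted orbit itself stays small, not only modulo
    polynomials. The cell is then the set contracted by the best block, whose volume is known. *)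
Lemma cell_prob_volume n N (b : nat) : (forall i j, lbound b (AL i j)) -> (b <= N)%N ->
  exists2 phi : {ffun 'I_d -> 'I_n.+1 * 'I_d},
    cell_prob n.+1 N * labs (\det (power_rows AL phi)) = (q ^+ (d * N))^-1 &
    forall psi : {ffun 'I_d -> 'I_n.+1 * 'I_d},
      labs (\det (power_rows AL psi)) <= labs (\det (power_rows AL phi)).
Proof.
move=> hb bN; have [phi [hmax hphi]] := best_power_rows R n AL.
exists phi => //; rewrite -(volume mu_haar N (X := power_rows AL phi)); last first.
  by move=> x /hphi/(_ 0%N isT); rewrite expr0 mul1mx.
congr (fine (P _) * _); apply/seteqP; split=> z; rewrite /contracted /= orbit_codeE.
  move=> /ffunP hz; apply/hphi; elim=> [|j IH] jn.
    rewrite expr0 mul1mx; apply/vbound_trunc; first exact: vbound_lift_vec.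
    by have := hz ord0; rewrite !ffunE expr0 mul1mx.
  apply/vbound_trunc; last by have := hz (Ordinal (jn : (j.+1 < n.+1)%N)); rewrite !ffunE.
  (* The degree is at most [b - (N + 1) <= -1]: no polynomial part appears, and vanishing digits
     mean smallness again. *)
  have : vbound (b%:Z + Negz N) (AL ^+ j.+1 *m lift_vec z).
    by rewrite exprS -mulmxA; apply: vboundM => //; apply: IH; exact: ltnW.
  by move=> h i; apply: lboundW (h i); rewrite NegzE; lia.
move=> /hphi h; apply/ffunP => j; rewrite !ffunE; apply: trunc_vec_small.
exact: h (leq_ord j).
Qed.

Section Growth.
Variables (K : closedFieldType) (iota : {rmorphism laurent F -> K}) (absK : K -> R).
Hypothesis absK_abs : is_absolute_value absK.
Hypothesis absK_ext : forall x : laurent F, absK (iota x) = labs x.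
Variable lambda : 'I_d -> K.
Hypothesis lambda_eigen :
  char_poly (map_mx iota AL) = \prod_(i < d) ('X - (lambda i)%:P).

Lemma absK_unbounded (B : R) : exists2 t : K, t != 0 & B <= absK t.
Proof.
have [t [t0 _ htV]] := monomial_ex F (Num.bound B)%:Z.
exists (iota t); first by rewrite fmorph_eq0.
rewrite absK_ext labsE//.
have dt : (Num.bound B)%:Z <= ldeg t.
  by move: htV; rewrite lbound_ldeg ?invr_eq0// ldegV// lerN2.
have qn n : (n%:R : R) <= q ^+ n.
  by rewrite -natrX ler_nat ltnW// ltn_expl// card_finNzRing_gt1.
apply: le_trans (_ : q ^ (Num.bound B)%:Z <= _); last first.
  by rewrite ler_eXz2l// card_field_gt1.
apply: le_trans (qn _); have [B0|B0] := leP 0 B; first exact: ltW (archi_boundP B0).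
by apply: le_trans (ltW B0) _.
Qed.

(** Positive characteristic makes [absK] ultrametric, through [absv_ultra]. *)
Lemma pchar_closure : exists p, p \in [pchar K].
Proof.
have [p p_pr pF] := finPcharP F; exists p.
apply: (rmorph_pchar iota); apply: (rmorph_pchar (@laurent_of_poly F)).
by apply: (rmorph_pchar (@polyC F)).
Qed.

Let m := \prod_(i < d) Num.max (absK (lambda i)) 1.

Lemma cell_prob_growth (b : nat) : (forall i j, lbound b (AL i j)) ->
  exists2 C : R, 0 < C & forall n N, (b <= N)%N -> exists2 M : R,
    cell_prob n.+1 N * M = (q ^+ (d * N))^-1 & M <= C * m ^+ n /\ m ^+ n <= C * M.
Proof.
move=> hb; have [p pK] := pchar_closure.
have [C C0 hC] := det_power_rows_growth absK_abs pK absK_unbounded lambda_eigen.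
exists C => // n N bN; have [phi hphi hmax] := cell_prob_volume n hb bN.
exists (labs (\det (power_rows AL phi))) => //.
have E psi : absK (\det (@power_rows _ _ n.+1 (map_mx iota AL) psi)) =
    labs (\det (power_rows AL psi)).
  rewrite -absK_ext -det_map_mx; congr (absK (\det _)).
  by apply/matrixP => i j; rewrite !mxE -rmorphXn /= mxE.
by apply: hC => [psi|]; [rewrite E|exists phi].
Qed.

Lemma cell_prob_cvg (b N : nat) : (forall i j, lbound b (AL i j)) -> (b <= N)%N ->
  (fun n => - ln (cell_prob n N) / n%:R) @ \oo -->
  \sum_(i < d) ln (Num.max (absK (lambda i)) 1).
Proof.
move=> hb bN; have [C C0 hC] := cell_prob_growth hb.
have m1 i : 0 < Num.max (absK (lambda i)) 1 :> R by rewrite lt_max ltr01 orbT.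
have m0 : 0 < m by apply: prodr_gt0.
have -> : \sum_(i < d) ln (Num.max (absK (lambda i)) 1) = ln m.
  rewrite /m; suff [] : \sum_(i < d) ln (Num.max (absK (lambda i)) 1) =
      ln (\prod_(i < d) Num.max (absK (lambda i)) 1) /\
      0 < \prod_(i < d) Num.max (absK (lambda i)) 1 by [].
  elim/big_rec2: _ => [|i x y _ [-> x0]]; first by rewrite ln1 ltr01.
  by rewrite mulr_gt0// lnM ?posrE.
(* The three terms absorb the volume factor, the comparison constant, and the shift between [n.+1]
   steps and the exponent [n]. *)
pose D := `|ln (q ^+ (d * N))| + `|ln C| + `|ln m|.
have bound n : `| - ln (cell_prob n.+1 N) - n.+1%:R * ln m | <= D.
  have [M hM [M1 M2]] := hC n N bN.
  have Q0 : 0 < q ^+ (d * N) by rewrite exprn_gt0// card_field_gt0.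
  have mn0 : 0 < m ^+ n by rewrite exprn_gt0.
  have M0 : 0 < M by rewrite -(pmulr_rgt0 _ C0); apply: lt_le_trans M2.
  have c0 : 0 < cell_prob n.+1 N.
    by rewrite -(pmulr_lgt0 _ M0) hM invr_gt0.
  have -> : - ln (cell_prob n.+1 N) = ln (q ^+ (d * N)) + ln M.
    have : ln (cell_prob n.+1 N * M) = ln (q ^+ (d * N))^-1 by rewrite hM.
    by rewrite lnM ?posrE// lnV ?posrE//; lra.
  have l1 : ln M <= ln C + n%:R * ln m.
    have : ln M <= ln (C * m ^+ n) by rewrite ler_ln// posrE mulr_gt0.
    by rewrite lnM ?posrE// lnXn// mulr_natl.
  have l2 : n%:R * ln m <= ln C + ln M.
    have : ln (m ^+ n) <= ln (C * M) by rewrite ler_ln// posrE mulr_gt0.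
    by rewrite lnM ?posrE// lnXn// mulr_natl.
  rewrite -natr1 mulrDl mul1r /D.
  have := ler_norm (ln (q ^+ (d * N))); have := ler_norm (- ln (q ^+ (d * N))).
  have := ler_norm (ln C); have := ler_norm (- ln m); have := ler_norm (ln m).
  rewrite !normrN => h1 h2 h3 h4 h5; rewrite ler_norml; apply/andP; split; lra.
rewrite -(cvg_shiftS (fun n => - ln (cell_prob n N) / n%:R)) /=.
apply/cvgrPdist_le => e e0; near=> n.
have n0 : 0 < n.+1%:R :> R by rewrite ltr0n.
rewrite distrC -[ln m](mulKf (lt0r_neq0 n0)) [n.+1%:R^-1 * _]mulrC -mulrBl.
rewrite normrM [`|_^-1|]gtr0_norm ?invr_gt0// ler_pdivrMr//.
apply: le_trans (bound n) _; rewrite -ler_pdivrMl// mulrC.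
near: n; exists (Num.bound (D / e)) => // n /= hn.
apply: le_trans (ltW (archi_boundP _)) _; first by rewrite divr_ge0 ?(ltW e0)// /D !addr_ge0.
by rewrite ler_nat (leq_trans hn).
Unshelve. all: end_near.
Qed.

End Growth.

End Cells.

(** * Measure entropy *)

Section WordEntropy.
Context {disp : measure_display} {T : measurableType disp} {R : realType}.
Variables (P : probability T R) (f : T -> T).
Hypothesis mf : measurable_fun setT f.
Hypothesis f_inv : forall E, measurable E -> P (f @^-1` E) = P E.

Local Notation pr E := (fine (P E)).

Definition word n (W : Type) (g : T -> W) (z : T) : {ffun 'I_n -> W} :=
  [ffun j : 'I_n => g (iter j f z)].

Lemma iter_measurable j (E : set T) : measurable E ->
  measurable (iter j f @^-1` E) /\ P (iter j f @^-1` E) = P E.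
Proof.
elim: j E => [|j IH] E mE //.
have mfE : measurable (f @^-1` E) by rewrite -[f @^-1` E]setTI; exact: mf.
by have [m1 m2] := IH _ mfE; split; [exact: m1|exact: etrans m2 (f_inv mE)].
Qed.

Lemma fibers_word n (W : Type) (g : T -> W) :
  fibers_measurable g -> fibers_measurable (word n g).
Proof.
move=> mg w; rewrite (_ : word n g @^-1` [set w] =
    \bigcap_(j in [set: 'I_n]) (iter j f @^-1` (g @^-1` [set w j]))).
  apply: fin_bigcap_measurable => // j _.
  by case: (@iter_measurable j _ (mg (w j))).
apply/seteqP; split=> [z /= <- j _|z /= hz]; first by rewrite /= ffunE.
by apply/ffunP => j; rewrite ffunE; exact: (hz j I).
Qed.

Lemma fibers_pair (V W : Type) (c : T -> V) (g : T -> W) :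
  fibers_measurable c -> fibers_measurable g ->
  fibers_measurable (fun z => (c z, g z)).
Proof.
move=> mc mg [v w]; rewrite (_ : _ @^-1` _ = c @^-1` [set v] `&` g @^-1` [set w]).
  exact: measurableI.
by apply/seteqP; split=> z /= [-> ->].
Qed.

Variables (V W : finType) (c : T -> V) (g : T -> W) (phi : V -> W).
Hypotheses (mc : fibers_measurable c) (mg : fibers_measurable g).

Definition mismatch : set T := [set z | g z != phi (c z)].

Lemma mismatch_measurable : measurable mismatch.
Proof.
exact: (fibers_preimage (fun vw : V * W => vw.2 != phi vw.1) (fibers_pair mc mg)).
Qed.

Lemma prob_joint (A B : finType) (a : T -> A) (b : T -> B) (S : pred (A * B)) :
  fibers_measurable a -> fibers_measurable b ->
  pr [set z | S (a z, b z)] =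
  \sum_(ab | S ab) pr (a @^-1` [set ab.1] `&` b @^-1` [set ab.2]).
Proof.
move=> ma mb; have -> := prob_preimage P S (fibers_pair ma mb).
by apply: eq_bigr => -[x y] _; congr (fine (P _)); apply/seteqP; split=> z /= [-> ->].
Qed.

Variables (n : nat) (e : R).
Hypothesis e01 : 0 < e < 1.

Local Notation K := (#|W|%:R : R).
Let p (vw : {ffun 'I_n -> V} * {ffun 'I_n -> W}) :=
  pr (word n c @^-1` [set vw.1] `&` word n g @^-1` [set vw.2]).
(** A mixture of the point mass at the guess [phi v] with the uniform law; it charges every letter,
    so its logarithm stays bounded below. *)
Let C v w := (1 - e) * (w == phi v)%:R + e / K.
Let r (vw : {ffun 'I_n -> V} * {ffun 'I_n -> W}) :=
  pr (word n c @^-1` [set vw.1]) * \prod_(j < n) C (vw.1 j) (vw.2 j).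

Let mwc : fibers_measurable (word n c). Proof. exact: fibers_word. Qed.
Let mwg : fibers_measurable (word n g). Proof. exact: fibers_word. Qed.

Let p_ge0 vw : 0 <= p vw. Proof. exact: fine_prob_ge0. Qed.

Let p_marg1 v : \sum_w p (v, w) = pr (word n c @^-1` [set v]).
Proof. by rewrite (prob_fibers P mwg). Qed.

Let p_marg2 w : \sum_v p (v, w) = pr (word n g @^-1` [set w]).
Proof.
rewrite (prob_fibers P mwc)//; apply: eq_bigr => v _.
by rewrite /p setIC.
Qed.

Let p_le1 v w : p (v, w) <= pr (word n c @^-1` [set v]).
Proof. by apply: fine_prob_le => //; exact: measurableI. Qed.

Let p_le2 v w : p (v, w) <= pr (word n g @^-1` [set w]).
Proof. by apply: fine_prob_le => //; exact: measurableI. Qed.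

Hypothesis K0 : 0 < K.

Let C_gt0 v w : 0 < C v w.
Proof.
case/andP: e01 => e0 e1; rewrite /C ltr_wpDl ?divr_gt0//.
by rewrite mulr_ge0// subr_ge0 ltW.
Qed.

Let C_sum v : \sum_w C v w = 1.
Proof.
rewrite big_split /= -mulr_sumr (bigD1 (phi v))//= eqxx big1 ?addr0 ?mulr1.
  by rewrite sumr_const -[_ *+ _]mulr_natr divfK ?gt_eqF// subrK.
by move=> w /negbTE ->.
Qed.

Let r_sum : \sum_vw r vw = 1.
Proof.
rewrite -(pair_bigA _ (fun v w => r (v, w)))/= -(sum_fibers P mwc).
apply: eq_bigr => v _; rewrite /r /= -mulr_sumr.
rewrite -(bigA_distr_bigA (fun j w => C (v j) w)) big1 ?mulr1//.
Qed.

(** A correct guess has weight at least [1 - e]; a wrong one has weight [e / K], which is at least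
    [(1 - e) * (e / K)]. *)
Let lnC v w : ln (1 - e) - (w != phi v)%:R * ln (K / e) <= ln (C v w).
Proof.
case/andP: e01 => e0 e1; have e1' : 0 < 1 - e by rewrite subr_gt0.
have eK : 0 < e / K by rewrite divr_gt0.
case: eqP => [->|wv] /=.
  rewrite mul0r subr0 ler_ln ?posrE// /C eqxx mulr1 lerDl.
  exact: ltW.
rewrite mul1r -lnV ?posrE ?divr_gt0// invf_div -lnM ?posrE//.
rewrite ler_ln ?posrE; [|exact: mulr_gt0|exact: C_gt0].
move/eqP/negbTE: wv; rewrite /C => ->; rewrite mulr0 add0r ler_piMl ?(ltW eK)//.
by rewrite lerBlDr lerDl ltW.
Qed.

(** By invariance of [P] a wrong guess is equally likely at every time [j]. *)
Let p_word (j : 'I_n) :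
  \sum_vw p vw * (vw.2 j != phi (vw.1 j))%:R = pr mismatch.
Proof.
have [m1 m2] := @iter_measurable j _ mismatch_measurable.
rewrite -m2 (_ : _ @^-1` _ = [set z | (fun vw : {ffun 'I_n -> V} * {ffun 'I_n -> W} =>
    vw.2 j != phi (vw.1 j)) (word n c z, word n g z)]); last first.
  by apply/seteqP; split=> z; rewrite /mismatch /= !ffunE.
rewrite (prob_joint (fun vw : {ffun 'I_n -> V} * {ffun 'I_n -> W} =>
    vw.2 j != phi (vw.1 j)) mwc mwg) [RHS]big_mkcond/=.
by apply: eq_bigr => vw _; case: ifP => _; rewrite ?mulr1 ?mulr0.
Qed.

(* Gibbs' inequality against the law [r] under which, given the [c]-word, the
   letters of the [g]-word are independent and close to the guesses [phi]. *)
Lemma entropy_word_le :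
  shannon_entropy P (fun w => word n g @^-1` [set w]) <=
  shannon_entropy P (fun v => word n c @^-1` [set v]) +
  n%:R * (- ln (1 - e) + ln (K / e) * pr mismatch).
Proof.
pose pc v := pr (word n c @^-1` [set v]); pose pg w := pr (word n g @^-1` [set w]).
(* This is [ln x <= x - 1] at [x = r vw / pg vw.2], followed by [p vw <= pg vw.2]. Summed over all
   pairs the right side vanishes, since [r] and [p] both have total mass 1. *)
have gibbs vw : p vw * (ln (pc vw.1) + \sum_j ln (C (vw.1 j) (vw.2 j)) - ln (pg vw.2))
    <= r vw - p vw.
  have [p0|pn0] := eqVneq (p vw) 0.
    rewrite p0 mul0r subr0 mulr_ge0 ?fine_prob_ge0//.
    by apply: prodr_ge0 => j _; apply: ltW.
  have pp : 0 < p vw by rewrite lt_def pn0 p_ge0.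
  case: vw pn0 pp => v w /= pn0 pp.
  have pc0 : 0 < pc v by apply: lt_le_trans pp (p_le1 v w).
  have pg0 : 0 < pg w by apply: lt_le_trans pp (p_le2 v w).
  have Pi0 : 0 < \prod_j C (v j) (w j) by apply: prodr_gt0.
  have -> : \sum_j ln (C (v j) (w j)) = ln (\prod_j C (v j) (w j)).
    suff [] : \sum_j ln (C (v j) (w j)) = ln (\prod_j C (v j) (w j)) /\
      0 < \prod_j C (v j) (w j) by [].
    elim/big_rec2: _ => [|i x y _ [-> x0]]; first by rewrite ln1 ltr01.
    by rewrite mulr_gt0// lnM ?posrE.
  have r0 : 0 < r (v, w) by rewrite mulr_gt0.
  rewrite -lnM ?posrE// -ln_div ?posrE//.
  have h : ln (r (v, w) / pg w) <= r (v, w) / pg w - 1.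
    have h0 : 0 < r (v, w) / pg w by rewrite divr_gt0.
    have := @le_ln1Dx _ (r (v, w) / pg w - 1); rewrite addrCA subrr addr0; apply.
    by rewrite ltrBDr addNr.
  apply: le_trans (ler_wpM2l (p_ge0 _) h) _.
  rewrite mulrBr mulr1 lerD2r mulrCA ler_piMr ?(ltW r0)//.
  by rewrite ler_pdivrMr// mul1r p_le2.
have := ler_sum (index_enum _) (fun vw (_ : true) => gibbs vw).
have p_sum : \sum_vw p vw = 1.
  rewrite -(pair_bigA _ (fun v w => p (v, w)))/= -(sum_fibers P mwc).
  by apply: eq_bigr => v _; rewrite p_marg1.
rewrite sumrB r_sum p_sum subrr.
under eq_bigr do rewrite mulrBr mulrDr.
rewrite sumrB big_split /=.
have -> : \sum_vw p vw * ln (pc vw.1) = - shannon_entropy P (fun v => word n c @^-1` [set v]).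
  rewrite /shannon_entropy opprK -(pair_bigA _ (fun v w => p (v, w) * ln (pc v)))/=.
  by apply: eq_bigr => v _; rewrite -mulr_suml p_marg1.
have -> : \sum_vw p vw * ln (pg vw.2) = - shannon_entropy P (fun w => word n g @^-1` [set w]).
  rewrite /shannon_entropy opprK -(pair_bigA _ (fun v w => p (v, w) * ln (pg w)))/=.
  by rewrite exchange_big /=; apply: eq_bigr => w _; rewrite -mulr_suml p_marg2.
have : n%:R * (ln (1 - e) - ln (K / e) * pr mismatch) <=
    \sum_vw p vw * \sum_j ln (C (vw.1 j) (vw.2 j)).
  under [leRHS]eq_bigr do rewrite mulr_sumr.
  rewrite exchange_big /= mulr_natl -[in leLHS](card_ord n) -sumr_const.
  apply: ler_sum => j _; rewrite -(p_word j) mulr_sumr.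
  have -> : ln (1 - e) = \sum_vw p vw * ln (1 - e) by rewrite -mulr_suml p_sum mul1r.
  rewrite -sumrB; apply: ler_sum => vw _.
  apply: le_trans (ler_wpM2l (p_ge0 vw) (lnC (vw.1 j) (vw.2 j))).
  by rewrite le_eqVlt; apply/orP; left; apply/eqP; ring.
move=> h1 h2; rewrite [n%:R * _](_ : _ =
    - (n%:R * (ln (1 - e) - ln (K / e) * pr mismatch))); last by ring.
by move: h1 h2; lra.
Qed.

End WordEntropy.

(** * Approximation of measurable sets by a generating algebra *)

Section Approximation.
Context {disp : measure_display} {T : measurableType disp} {R : realType}.
Variables (P : probability T R) (G : set (set T)).
Hypothesis G0 : G set0.
Hypothesis GC : forall C, G C -> G (~` C).
Hypothesis GU : forall C D, G C -> G D -> G (C `|` D).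
Hypothesis GM : @measurable _ T = <<s G >>.

Local Notation pr E := (fine (P E)).

Definition symdiff (E C : set T) := (E `\` C) `|` (C `\` E).

Let mG C : G C -> measurable C.
Proof. by move=> GC'; rewrite GM; apply: sub_sigma_algebra. Qed.

Let mS E C : measurable E -> measurable C -> measurable (symdiff E C).
Proof. by move=> mE mC; apply: measurableU; apply: measurableD. Qed.

Lemma fine_probU_le (E C : set T) : measurable E -> measurable C ->
  pr (E `|` C) <= pr E + pr C.
Proof.
move=> mE mC; rewrite -lee_fin EFinD !fine_probK//; last exact: measurableU.
exact: measureU2.
Qed.

Let approx : set (set T) :=
  [set E | measurable E /\ forall delta : R, 0 < delta ->
    exists2 C, G C & pr (symdiff E C) <= delta].

Let approxU E E' : approx E -> approx E' -> approx (E `|` E').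
Proof.
move=> [mE hE] [mE' hE']; split; first exact: measurableU.
move=> delta d0; have d2 : 0 < delta / 2 by rewrite divr_gt0.
have [C GC1 hC] := hE _ d2; have [C' GC2 hC'] := hE' _ d2.
exists (C `|` C'); first exact: GU.
have mC := mG GC1; have mC' := mG GC2.
apply: (@le_trans _ _ (pr (symdiff E C `|` symdiff E' C'))).
  apply: fine_prob_le; [by apply: mS; apply: measurableU|by apply: measurableU; apply: mS|].
  by rewrite /symdiff => z /=; tauto.
apply: le_trans (fine_probU_le _ _) _; [exact: mS|exact: mS|].
by rewrite [leRHS]splitr lerD.
Qed.

(** The approximable sets form a sigma-algebra containing [G]. *)
Lemma measurable_approx E : measurable E -> forall delta : R, 0 < delta ->
  exists2 C, G C & pr (symdiff E C) <= delta.
Proof.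
move=> mE; suff : approx E by case.
move: E mE; change (@measurable _ T `<=` approx); rewrite GM.
apply: smallest_sub; last first.
  move=> C GC'; split=> [|delta d0]; first exact: mG.
  exists C => //; rewrite /symdiff setDv setU0 measure0; exact: ltW.
have a0 : approx set0.
  split=> // delta d0; exists set0 => //.
  by rewrite /symdiff setDv setU0 measure0; exact: ltW.
split=> // [E [mE hE]|E hE].
  rewrite setTD; split=> [|delta d0]; first exact: measurableC.
  have [C GC1 hC] := hE _ d0; exists (~` C); first exact: GC.
  rewrite (_ : symdiff _ _ = symdiff E C)//.
  apply/seteqP; rewrite /symdiff; split=> z /=;
    case: (pselect (E z)); case: (pselect (C z)); tauto.
have mE n : measurable (E n) by case: (hE n).
pose S n := \big[setU/set0]_(i < n) E i.
have aS n : approx (S n).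
  rewrite /S; elim: n => [|n IH]; first by rewrite big_ord0.
  by rewrite big_ord_recr; apply: approxU.
have SE : \bigcup_n S n = \bigcup_n E n.
  apply/seteqP; split=> z [n _]; first by rewrite /S -bigcup_mkord => -[i _ Ez]; exists i.
  by move=> Ez; exists n.+1 => //; rewrite /S big_ord_recr; right.
have mU : measurable (\bigcup_n E n) by exact: bigcup_measurable.
have mSn n : measurable (S n) by case: (aS n).
split=> // delta d0; have d2 : 0 < delta / 2 by rewrite divr_gt0.
(* Continuity from below: half of [delta] pays for cutting the union at a finite stage, half for
   approximating that stage. *)
have : P \o S @ \oo --> P (\bigcup_n S n).
  apply: nondecreasing_cvg_mu => //; first by rewrite SE.
  by apply/nondecreasing_seqP => n; apply/subsetPset; rewrite /S big_ord_recr; left.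
rewrite SE -(fine_probK P mU) => /fine_cvg/cvgrPdist_le/(_ _ d2)[n _ /(_ n (leqnn n))] hn.
have [C GC1 hC] := (aS n).2 _ d2; exists C => //.
have mC := mG GC1; have SU : S n `<=` \bigcup_n E n by rewrite -SE; exact: bigcup_sup.
have hD : pr (\bigcup_n E n `\` S n) <= delta / 2.
  apply: le_trans hn => /=; apply: le_trans (ler_norm _).
  rewrite -lee_fin fine_probK; last exact: measurableD.
  rewrite measureD//; last by rewrite -ge0_fin_numE ?fin_num_measure.
  by rewrite setIidr// EFinB !fine_probK.
apply: (@le_trans _ _ (pr ((\bigcup_n E n `\` S n) `|` symdiff (S n) C))).
  apply: fine_prob_le; [exact: mS|by apply: measurableU; [exact: measurableD|exact: mS]|].
  rewrite /symdiff => z /=; case: (pselect (S n z)) => [Sz|]; last tauto.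
  by have := SU _ Sz; tauto.
apply: le_trans (fine_probU_le _ _) _; [exact: measurableD|exact: mS|].
by rewrite [leRHS]splitr lerD.
Qed.

End Approximation.

(** * The algebra of cylinders *)

Section Cylinders.
Variables (F : finFieldType) (d : nat).
Local Notation X := (d.-tuple (borel_torus F)).

Definition cylinder : set (set X) :=
  [set C | exists N (S : pred 'M[F]_(d, N)), C = [set z | S (trunc N z)]].

Lemma trunc_widen N M (NM : (N <= M)%N) (z : d.-tuple (torus F)) :
  trunc N z = \matrix_(i, k) trunc M z i (widen_ord NM k).
Proof. by apply/matrixP => i k; rewrite !mxE. Qed.

Lemma cylinder_widen C N0 : cylinder C -> exists2 N, (N0 <= N)%N &
  exists S : pred 'M[F]_(d, N), C = [set z | S (trunc N z)].
Proof.
move=> [N [S ->]]; exists (maxn N0 N); first exact: leq_maxl.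
exists (fun v : 'M[F]_(d, _) => S (\matrix_(i, k) v i (widen_ord (leq_maxr N0 N) k))).
by apply/seteqP; split=> z /=; rewrite (trunc_widen (leq_maxr N0 N)).
Qed.

Lemma cylinder0 : cylinder set0.
Proof. by exists 0%N, pred0; apply/seteqP; split=> z. Qed.

Lemma cylinderC C : cylinder C -> cylinder (~` C).
Proof.
move=> [N [S ->]]; exists N, (predC S); apply/seteqP; split=> z /=; first by move/negP.
by move=> /negP.
Qed.

Lemma cylinderU C D : cylinder C -> cylinder D -> cylinder (C `|` D).
Proof.
move=> [N [S ->]] /(cylinder_widen N)[M NM [S' ->]].
exists M, (fun v : 'M[F]_(d, M) => S (\matrix_(i, k) v i (widen_ord NM k)) || S' v).
apply/seteqP; split=> z /=; rewrite (trunc_widen NM).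
  by case=> ->; rewrite ?orbT.
by move/orP.
Qed.

Lemma cylinderI : setI_closed cylinder.
Proof.
move=> C D hC hD; rewrite -[C `&` D]setCK setCI; apply: cylinderC.
by apply: cylinderU; apply: cylinderC.
Qed.

Lemma measurable_cylinder : @measurable _ X = <<s cylinder >>.
Proof.
apply/seteqP; split; last first.
  apply: smallest_sub; first exact: sigma_algebra_measurable.
  move=> _ [N [S ->]]; exact: (fibers_preimage S (@trunc_measurable F d N)).
pose Y := g_sigma_algebraType cylinder.
have mid : measurable_fun [set: Y] (fun z : Y => z : X).
  apply/measurable_fun_tnthP => i.
  apply: (@measurability _ _ Y (borel_torus F) setT _ (@open (torus F))) => //.
  move=> _ [U oU <-]; rewrite setTI.
  (* An open [U] is the countable union over [N] of the points whose whole digit ball of depth [N]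
     lies in [U]. *)
  pose S N (w : {ffun 'I_N -> F}) := `[< forall b, digits N b = w -> U b >].
  rewrite (_ : _ @^-1` U = \bigcup_N [set z : X | S N (digits N (tnth z i))]).
    apply: bigcup_measurable => N _; apply: sub_sigma_algebra.
    exists N, (fun v => S N [ffun k => v i k]); apply/seteqP; split=> z /=;
      congr (is_true (S N _)); apply/ffunP => k; rewrite !ffunE !mxE //.
  apply/seteqP; split=> z /=; last by move=> [N _ /asboolP]; apply.
  move=> Uz; have := oU (torus_lift (tnth z i)); rewrite /= torus_liftK => /(_ Uz)[N hN].
  exists `|N|%N => //; apply/asboolP => b hb; rewrite -(torus_liftK b).
  apply: hN => -[k|k] Nk; first by rewrite !torus_lift_neg.
  have kN : (k < `|N|)%N by move: Nk; case: (N) => m //; rewrite !NegzE; lia.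
  by have /ffunP/(_ (Ordinal kN)) := hb; rewrite !ffunE.
by move=> E mE; have := mid measurableT E mE; rewrite setTI.
Qed.

End Cylinders.

Section EntropyUniform.
Context {disp : measure_display} {T : measurableType disp} {R : realType}.
Variable P : probability T R.

Lemma entropy_uniform (W : finType) (g : T -> W) (p : R) : fibers_measurable g ->
  (forall z, fine (P (g @^-1` [set g z])) = p) ->
  shannon_entropy P (fun w => g @^-1` [set w]) = - ln p.
Proof.
move=> mg gp; rewrite /shannon_entropy; congr (- _).
rewrite (eq_bigr (fun w => fine (P (g @^-1` [set w])) * ln p)); last first.
  move=> w _; have [[z <-]|nz] := pselect (exists z, g z = w); first by rewrite gp.
  rewrite (_ : g @^-1` _ = set0) ?measure0 ?mul0r//.
  by apply/seteqP; split=> z //= gz; apply: nz; exists z.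
by rewrite -mulr_suml sum_fibers// mul1r.
Qed.

Lemma fine_prob_bigU_le (I : finType) (E : I -> set T) : (forall i, measurable (E i)) ->
  measurable (\big[setU/set0]_i E i) /\
  fine (P (\big[setU/set0]_i E i)) <= \sum_i fine (P (E i)).
Proof.
move=> mE; elim/big_rec2: _ => [|i x y _ [my xy]]; first by rewrite measure0.
split; first exact: measurableU.
by apply: le_trans (fine_probU_le _ _ my) _ => //; rewrite lerD2l.
Qed.

Lemma join_partition_word (f : T -> T) (k n : nat) (xi : 'I_k -> set T) (g : T -> 'I_k) w :
  (forall i, xi i = g @^-1` [set i]) ->
  join_partition f xi (n := n) w = word f n g @^-1` [set w].
Proof.
move=> xig; apply/seteqP; split=> z /= hz.
  by apply/ffunP => j; have := hz j I; rewrite /= xig /= ffunE.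
by move=> j _; rewrite /= xig /= -hz ffunE.
Qed.

Lemma partition_index (k : nat) (xi : 'I_k -> set T) : measurable_partition xi ->
  exists2 g : T -> 'I_k, fibers_measurable g & forall i, xi i = g @^-1` [set i].
Proof.
move=> [mxi txi cxi].
have hz z : exists i, xi i z.
  by have : (\bigcup_i xi i) z by [rewrite cxi]; move=> [i _ xz]; exists i.
pose g z := projT1 (cid (hz z)).
have xig i : xi i = g @^-1` [set i].
  apply/seteqP; split=> z /=; rewrite /g; case: cid => j /= xj; last by move=> <-.
  by move=> xi_z; apply: (txi j i) => //; exists z.
by exists g => // i; rewrite -xig.
Qed.

End EntropyUniform.

(** * Invariance of the product measure *)

Section Invariance.
Variables (R : realType) (F : finFieldType) (mu : probability (borel_torus F) R).
Hypothesis mu_haar : is_haar mu.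
Variables (d : nat) (A : 'M[{poly F}]_d).
Local Notation AL := (map_mx (@laurent_of_poly F) A).
Local Notation P := (prod_measure mu d).
Local Notation X := (d.-tuple (borel_torus F)).
Local Notation f := (torus_mulmx A : X -> X).

Let h N (x : 'cV[laurent F]_d) := trunc_vec N (AL *m x).

Let hB N : zmod_morphism (h N).
Proof. by move=> x y; rewrite /h mulmxBr trunc_vecB. Qed.

Let h_small N : exists M : nat, forall x, vbound (Negz M) x -> h N x = 0.
Proof.
have [b hb] := mx_lbound AL; exists (N + b)%N => x hx; apply: trunc_vec_small.
rewrite (_ : Negz N = b%:Z + Negz (N + b)); first exact: vboundM.
by rewrite !NegzE; lia.
Qed.

Let trunc_mulmx N (z : X) : trunc N (f z) = h N (lift_vec z).
Proof. by have := trunc_iter A N 1 z; rewrite expr1. Qed.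

Let trunc_mulmx_fibers N : fibers_measurable (fun z : X => trunc N (f z)).
Proof.
have [M hM] := h_small N; have := quotient_measurable (hB N) hM.
by under [X in _ -> fibers_measurable X]eq_fun do rewrite trunc_mulmx.
Qed.

Lemma torus_mulmx_measurable : measurable_fun setT f.
Proof.
apply: (@measurability _ _ X X setT f (@cylinder F d)).
  exact: measurable_cylinder.
move=> _ [_ [N [S ->]] <-]; rewrite setTI.
exact: (fibers_preimage S (trunc_mulmx_fibers (N := N))).
Qed.

(** It suffices to compare the two laws on cylinders. Truncation before and after applying [A] are
    both surjective homomorphisms onto the same finite group, so both laws give each digit matrix
    the same mass. *)
Lemma torus_mulmx_invariant : \det A != 0 ->
  forall E, measurable E -> P (f @^-1` E) = P E.
Proof.
move=> detA E mE; pose g : {mfun X >-> X} := mfun_Sub (mem_set torus_mulmx_measurable).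
have surj N (v : 'M[F]_(d, N)) : exists z : X, trunc N z = v.
  by exists (torus_proj (digit_vec v)); rewrite trunc_proj digit_vecK.
have id_small N x : vbound (Negz N) x -> trunc_vec N x = 0 := @trunc_vec_small F d N x.
apply: (@measure_unique _ R X (@cylinder F d) (fun=> setT) _ _ _ _
  (distribution P g) P) => //.
- exact: measurable_cylinder.
- exact: cylinderI.
- by move=> _; rewrite -setC0; apply: cylinderC; exact: cylinder0.
- by apply/seteqP; split=> // z _; exists 0%N.
- move=> C [N [S eC]].
  have mC : measurable C by rewrite eC; exact: (fibers_preimage S (@trunc_measurable F d N)).
  have mfC : measurable (f @^-1` C).
    by rewrite -[f @^-1` C]setTI; exact: torus_mulmx_measurable.
  rewrite -[LHS]/(P (f @^-1` C)) -[RHS]/(P C) -(fine_probK P mC) -(fine_probK P mfC).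
  rewrite eC; congr (_%:E).
  transitivity (\sum_(v | S v) fine (P ((fun z : X => trunc N (f z)) @^-1` [set v]))).
    exact: (prob_preimage P S (trunc_mulmx_fibers (N := N))).
  rewrite (prob_preimage P S (@trunc_measurable F d N)); apply: eq_bigr => v _.
  have [M hM] := h_small N.
  rewrite [RHS](quotient_fiber_surj mu_haar (@trunc_vecB F d N) (@id_small N) (surj N)).
  have hsurj w : exists z : X, h N (lift_vec z) = w.
    have [z zw] := surj N w; have [z' zz'] := torus_mulmx_surj detA z.
    by exists z'; rewrite -trunc_mulmx zz'.
  rewrite -(quotient_fiber_surj mu_haar (hB N) hM hsurj v).
  by congr (fine (P _)); apply/seteqP; split=> z /=; rewrite trunc_mulmx.
- by move=> k; rewrite -[X in (X < _)%E]/(P setT) probability_setT ltry.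
Qed.

End Invariance.

Section CylinderGuess.
Variables (R : realType) (F : finFieldType) (d : nat).
Local Notation X := (d.-tuple (borel_torus F)).
Variable P : probability X R.

(** Each cell is approximated by a cylinder, all brought to a common depth; the guess is an index
    whose cylinder contains the point. *)
Lemma cylinder_guess (k : nat) (g : X -> 'I_k.+1) (N0 : nat) (delta : R) :
  fibers_measurable g -> 0 < delta ->
  exists2 N, (N0 <= N)%N & exists phi : 'M[F]_(d, N) -> 'I_k.+1,
    fine (P (mismatch (trunc N : X -> 'M[F]_(d, N)) g phi)) <= delta.
Proof.
move=> mg d0; have dk : 0 < delta / k.+1%:R by rewrite divr_gt0.
have hC i := measurable_approx P (@cylinder0 F d) (@cylinderC F d) (@cylinderU F d)
  (@measurable_cylinder F d) (mg i) dk.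
pose C i := projT1 (cid2 (hC i)).
have CC i : cylinder (C i) by rewrite /C; case: cid2.
have CE i : fine (P (symdiff (g @^-1` [set i]) (C i))) <= delta / k.+1%:R.
  by rewrite /C; case: cid2.
pose Nc i := projT1 (cid (CC i)).
pose N := maxn N0 (\max_i Nc i).
have NcN i : (Nc i <= N)%N by apply: leq_trans (leq_maxr _ _); exact: leq_bigmax.
have hS i : exists S : pred 'M[F]_(d, N), C i = [set z | S (trunc N z)].
  move: (NcN i); rewrite /Nc; case: cid => M /= hM MN; have [S CS] := hM.
  exists (fun v : 'M[F]_(d, N) => S (\matrix_(i, k) v i (widen_ord MN k))).
  by rewrite CS; apply/seteqP; split=> z /=; rewrite (trunc_widen MN).
pose S i := projT1 (cid (hS i)).
have SE i : C i = [set z | S i (trunc N z)] by rewrite /S; case: cid.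
exists N; first exact: leq_maxl.
exists (fun v => odflt ord0 [pick i | S i v]); set phi := fun v => _.
have mC i : measurable (C i).
  by rewrite measurable_cylinder; apply: sub_sigma_algebra.
have mS i : measurable (symdiff (g @^-1` [set i]) (C i)).
  by apply: measurableU; apply: measurableD.
have [mU leU] := fine_prob_bigU_le P mS.
apply: (@le_trans _ _ (\sum_(i < k.+1) delta / k.+1%:R)); last first.
  by rewrite sumr_const card_ord -[_ *+ _]mulr_natr divfK.
apply: le_trans (le_trans leU (ler_sum _ (fun i _ => CE i))).
apply: fine_prob_le => //.
  by apply: mismatch_measurable => //; exact: trunc_measurable.
(* Off all the symmetric differences, [z] lies in the cylinder of index [g z] and in no other, so
   the guess is right. *)
move=> z /= gz; apply: contrapT => nz.
have hz i : S i (trunc N z) = (g z == i).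
  apply/idP/eqP => [Sz|giz].
    apply: contrapT => giz; apply: nz; rewrite (bigD1 i)//=; left; right.
    by rewrite SE.
  apply: contrapT => Sz; apply: nz; rewrite (bigD1 i)//=; left; left.
  by rewrite SE.
move: gz; rewrite /mismatch /= /phi; case: pickP => [i|/(_ (g z))] /=; rewrite hz.
  by move=> /eqP ->; rewrite eqxx.
by rewrite eqxx.
Qed.

End CylinderGuess.

Section MeasureEntropy.
Variables (R : realType) (F : finFieldType) (mu : probability (borel_torus F) R).
Hypothesis mu_haar : is_haar mu.
Variables (d : nat) (A : 'M[{poly F}]_d).
Hypothesis detA : \det A != 0.
Local Notation P := (prod_measure mu d).
Local Notation X := (d.-tuple (borel_torus F)).
Local Notation f := (torus_mulmx A : X -> X).
Local Notation cell_prob := (cell_prob mu A).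

Variables (b : nat) (h : R).
Hypothesis h0 : 0 <= h.
Hypothesis cell_cvg : forall N, (b <= N)%N ->
  (fun n => - ln (cell_prob n N) / n%:R) @ \oo --> h.

Lemma partition_entropy_le (k : nat) (xi : 'I_k -> set X) :
  measurable_partition xi -> partition_entropy P f xi <= h.
Proof.
case: k xi => [|k] xi hxi.
  by have [g _ _] := partition_index hxi; case: (g point).
have [g mg xig] := partition_index hxi; rewrite /partition_entropy.
set u := fun n : nat => _.
(* A divergent sequence has the junk limit [0 <= h]. *)
have [cu|/dvgP ->//] := pselect (cvgn u).
apply/ler_addgt0Pr => eta eta0.
have eta3 : 0 < eta / 3 by rewrite divr_gt0.
(* Chosen so that the term [- ln (1 - e)] is exactly [eta / 3]. *)
pose e := 1 - expR (- (eta / 3)).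
have e1 : 1 - e = expR (- (eta / 3)) by rewrite /e subKr.
have e01 : 0 < e < 1.
  by rewrite subr_gt0 expR_lt1 oppr_lt0 eta3 /= ltrBlDr ltrDl expR_gt0.
have /andP[e_gt0 e_lt1] := e01.
pose K : R := #|'I_k.+1|%:R.
have K1 : 1 <= K by rewrite /K card_ord ler1n.
have L0 : 0 <= ln (K / e).
  by rewrite ln_ge0// ler_pdivlMr// mul1r; apply: le_trans K1; exact: ltW.
(* At this mismatch level the wrong guesses cost at most [eta / 3] per letter; adding 1 avoids a
   zero denominator. The last third is spent on the convergence of the cylinder rate. *)
have d0 : 0 < eta / 3 / (ln (K / e) + 1) by rewrite divr_gt0// ltr_wpDl.
have [N bN [phi hphi]] := cylinder_guess P b mg d0.
have step n : shannon_entropy P (join_partition f xi (n := n)) <=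
    - ln (cell_prob n N) + n%:R * (eta / 3 + eta / 3).
  rewrite (_ : join_partition f xi (n := n) = fun w => word f n g @^-1` [set w]); last first.
    by apply/funext => w; exact: join_partition_word.
  have := entropy_word_le (torus_mulmx_measurable A) (torus_mulmx_invariant mu_haar detA)
    phi (@trunc_measurable F d N) mg n e01.
  rewrite -/K => /(_ (lt_le_trans ltr01 K1))/le_trans; apply.
  rewrite (entropy_uniform (p := cell_prob n N)); last 2 first.
  - exact: orbit_code_measurable.
  - by move=> z; exact: orbit_code_prob.
  rewrite lerD2l ler_wpM2l// lerD//; first by rewrite e1 expRK opprK.
  apply: le_trans (ler_wpM2l L0 hphi) _.
  rewrite mulrCA ler_piMr ?(ltW eta3)// ler_pdivrMr ?ltr_wpDl// mul1r.
  by rewrite lerDl.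
apply: limr_le => //.
have /cvgrPdist_le/(_ _ eta3) := cell_cvg bN.
apply: filterS2 (nbhs_infty_gt 0) => n n0 hn.
have nn0 : 0 < n%:R :> R by rewrite ltr0n.
have : u n <= - ln (cell_prob n N) / n%:R + (eta / 3 + eta / 3).
  by rewrite /u ler_pdivrMr// mulrDl divfK ?gt_eqF// [_ * n%:R]mulrC.
move=> /le_trans; apply.
move: hn; rewrite distrC ler_norml => /andP[_]; rewrite lerBlDr => hn.
apply: le_trans (lerD hn (lexx _)) _.
by rewrite le_eqVlt; apply/orP; left; apply/eqP; field.
Qed.

(** The cells of the join are those of the orbit code and have equal mass, so the supremum is
    attained by cylinders. Digit matrices are enumerated because partitions are indexed by
    ordinals. *)
Lemma cylinder_partition_entropy (N : nat) : (b <= N)%N ->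
  let xi (i : 'I_#|{: 'M[F]_(d, N)}|) : set X := trunc N @^-1` [set enum_val i] in
  measurable_partition xi /\ partition_entropy P f xi = h.
Proof.
move=> bN xi; pose g (z : X) := enum_rank (trunc N z).
have xig i : xi i = g @^-1` [set i].
  apply/seteqP; split=> z /=; rewrite /xi /g /=; first by move=> ->; rewrite enum_valK.
  by move=> <-; rewrite enum_rankK.
have mxi i : measurable (xi i) by exact: trunc_measurable.
split.
  split=> //; first by move=> i j _ _ [z]; rewrite !xig => -[/= -> ->].
  by apply/seteqP; split=> // z _; exists (g z); rewrite // xig.
rewrite /partition_entropy; apply/cvg_lim => //.
rewrite (_ : (fun n => _) = (fun n => - ln (cell_prob n N) / n%:R)); first exact: cell_cvg.
apply/funext => n; congr (_ / _).
rewrite (_ : join_partition f xi (n := n) = fun w => word f n g @^-1` [set w]); last first.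
  by apply/funext => w; exact: join_partition_word.
have mg : fibers_measurable g by move=> i; rewrite -xig.
apply: entropy_uniform => [|z].
  apply: fibers_word => //; first exact: torus_mulmx_measurable.
  exact: (torus_mulmx_invariant mu_haar detA).
rewrite -(orbit_code_prob mu_haar A n N z); congr (fine (P _)).
apply/seteqP; split=> z' /= /ffunP hz; apply/ffunP => j; have := hz j; rewrite !ffunE.
  exact: enum_rank_inj.
by move=> e; rewrite /g e.
Qed.

Lemma measure_entropy_torus : measure_entropy P f = h%:E.
Proof.
apply/eqP; rewrite eq_le; apply/andP; split.
  apply: ge_ereal_sup => _ [k [xi [hxi ->]]]; rewrite lee_fin.
  exact: partition_entropy_le.
have [hxi <-] := cylinder_partition_entropy (leqnn b).
by apply: ereal_sup_ubound; do 2 eexists; split; first exact: hxi.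
Qed.

End MeasureEntropy.

(** * Topological entropy *)

Section TopologicalEntropy.
Variables (R : realType) (F : finFieldType) (mu : probability (borel_torus F) R).
Hypothesis mu_haar : is_haar mu.
Variables (d : nat) (A : 'M[{poly F}]_d).
Local Notation q := (#|F|%:R : R).
Local Notation X := (d.-tuple (borel_torus F)).
Local Notation f := (torus_mulmx A).
Local Notation cell_prob := (cell_prob mu A).
Local Notation code := (orbit_code A).

(** Distances are 0 or integer powers of [q], so on this range of [e] exceeding [e] amounts to
    differing in one of the first [N] digits. *)
Lemma torus_dist_trunc N (e : R) (x y : d.-tuple (torus F)) :
  q ^- N.+1 <= e < q ^- N -> (e < torus_dist R x y) = (trunc N x != trunc N y).
Proof.
move=> /andP[e1 e2]; have e0 : 0 <= e.
  by apply: le_trans e1; rewrite invr_ge0 exprn_ge0// ltW// card_field_gt0.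
have D : trunc N x - trunc N y = trunc_vec N (lift_vec x - lift_vec y).
  by rewrite trunc_vecB.
have hv := vboundB (vbound_lift_vec x) (vbound_lift_vec y).
apply/idP/idP => [|xy].
  apply: contraTneq => xy; rewrite -leNgt /torus_dist.
  apply/bigmax_leP; split=> // i _; apply: le_trans e1.
  have /vbound_trunc -/(_ hv)/(_ i) : trunc_vec N (lift_vec x - lift_vec y) = 0.
    by rewrite -D xy subrr.
  by rewrite !mxE => /(labs_le R) //.
have [i [k xik]] : exists i k, (trunc N x - trunc N y) i k != 0.
  apply: contrapT => nik; move: xy; rewrite -subr_eq0 => /eqP; apply.
  apply/matrixP => i k; rewrite [RHS]mxE; apply/eqP; apply: contrapT => /negP ik.
  by apply: nik; exists i, k.
have xi : (torus_lift (tnth x i) - torus_lift (tnth y i)) (Negz k) != 0.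
  by move: xik; rewrite !mxE.
apply: lt_le_trans (le_bigmax_cond _ _ (isT : xpredT i)).
have x0 : torus_lift (tnth x i) - torus_lift (tnth y i) != 0.
  by apply: contraNneq xi => ->; rewrite lcoef0.
apply: lt_le_trans e2 _; rewrite labsE// exprnN ler_eXz2l ?card_field_gt1//.
rewrite leNgt; apply: contra xi => h; have [_ ->//] := ldegP x0.
by apply: lt_le_trans h _; rewrite NegzE lerN2 lez_nat.
Qed.

Lemma bowen_dist_code n N (e : R) (x y : X) : q ^- N.+1 <= e < q ^- N ->
  (e < bowen_dist (@torus_dist R F d) f n x y) = (code n N x != code n N y).
Proof.
move=> he; have e0 : 0 <= e.
  case/andP: he => e1 _; apply: le_trans e1.
  by rewrite invr_ge0 exprn_ge0// ltW// card_field_gt0.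
apply/idP/idP => [|xy].
  apply: contraTneq => /ffunP xy; rewrite -leNgt; apply/bigmax_leP; split=> // j _.
  by rewrite leNgt (torus_dist_trunc _ _ he); have := xy j; rewrite !ffunE => ->; rewrite eqxx.
have [j xj] : exists j, code n N x j != code n N y j.
  apply: contrapT => nj; move/eqP: xy; apply; apply/ffunP => j.
  by apply/eqP; apply: contrapT => /negP h; apply: nj; exists j.
apply: lt_le_trans (le_bigmax_cond _ _ (isT : xpredT j)).
by rewrite (torus_dist_trunc _ _ he); move: xj; rewrite !ffunE.
Qed.

(** Separated points have distinct codes, and one point for each attained code gives a largest
    separated set. The nonempty cells have equal mass, so their number is the inverse of
    [cell_prob n N]. *)
Lemma max_separated_code n N (e : R) : q ^- N.+1 <= e < q ^- N ->
  lne (max_separated (@torus_dist R F d) f n e) = (- ln (cell_prob n N))%:E.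
Proof.
move=> he; pose I := [set w | `[< exists z, code n N z = w >]]%SET.
have mc := @orbit_code_measurable F d A n N.
have cardI : #|I|%:R * cell_prob n N = 1.
  rewrite -[RHS](sum_fibers (prod_measure mu d) mc) (bigID (mem I))/=.
  rewrite [X in _ = _ + X]big1 ?addr0.
    rewrite (eq_bigr (fun=> cell_prob n N)) ?sumr_const ?mulr_natl// => w.
    by rewrite inE => /asboolP[z <-]; exact: orbit_code_prob.
  move=> w; rewrite inE => /asboolP nw; rewrite (_ : _ @^-1` _ = set0) ?measure0//.
  by apply/seteqP; split=> z //= zw; apply: nw; exists z.
have p0 : 0 < cell_prob n N.
  rewrite lt_def fine_prob_ge0 andbT; apply/eqP => p0.
  by move: cardI; rewrite p0 mulr0 => /eqP; rewrite eq_sym oner_eq0.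
have I0 : (0 : R) < #|I|%:R by rewrite -(pmulr_lgt0 _ p0) cardI.
rewrite (_ : max_separated _ _ _ _ = #|I|%:R%:E).
  rewrite lne_EFin//; congr (_%:E); have := congr1 (@ln R) cardI.
  by rewrite ln1 lnM ?posrE//; lra.
apply/eqP; rewrite eq_le; apply/andP; split.
  apply: ge_ereal_sup => _ [s [us hs] <-]; rewrite lee_fin ler_nat.
  rewrite -(size_map (code n N)) cardE; apply: uniq_leq_size => [|w].
    rewrite map_inj_in_uniq// => x y xs ys xy; apply/eqP; apply: contrapT => /negP nxy.
    by have := hs x y xs ys nxy; rewrite (bowen_dist_code _ _ _ he) xy eqxx.
  by move=> /mapP[z _ ->]; rewrite mem_enum inE; apply/asboolP; exists z.
have hz (w : {ffun 'I_n -> 'M[F]_(d, N)}) : exists z : X, w \in I -> code n N z = w.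
  have [|nw] := boolP (w \in I); last by exists point.
  by rewrite inE => /asboolP[z zw]; exists z.
pose z w := projT1 (cid (hz w)).
have zE w : w \in I -> code n N (z w) = w by rewrite /z; case: cid.
apply: ereal_sup_ubound; exists [seq z w | w <- enum I]; last by rewrite size_map -cardE.
split.
  rewrite map_inj_in_uniq ?enum_uniq// => v w; rewrite !mem_enum => vI wI.
  by move=> /(congr1 (code n N)); rewrite !zE.
move=> _ _ /mapP[v + ->] /mapP[w + ->]; rewrite !mem_enum => vI wI zvw.
rewrite (bowen_dist_code _ _ _ he) !zE//.
by apply: contra_neq zvw => ->.
Qed.

(** [N.+1] is the least exponent [M] with [q ^- M <= e]. *)
Lemma scale_ex (b : nat) (e : R) : 0 < e -> e < q ^- b ->
  exists2 N, (b <= N)%N & q ^- N.+1 <= e < q ^- N.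
Proof.
move=> e0 eb; have q0 := card_field_gt0 R F.
have exM : exists M, q ^- M <= e.
  have [B eB] : exists B : nat, e^-1 <= B%:R.
    by exists (Num.bound e^-1); apply/ltW/archi_boundP; rewrite invr_ge0 ltW.
  exists B; rewrite -[e]invrK lef_pV2 ?posrE ?invr_gt0 ?exprn_gt0//.
  by apply: le_trans eB _; rewrite -natrX ler_nat ltnW// ltn_expl// card_finNzRing_gt1.
have [M hM minM] := ex_minnP exM.
have bM : (b < M)%N.
  rewrite ltnNge; apply/negP => Mb; move: eb; rewrite ltNge => /negP; apply.
  apply: le_trans hM; rewrite lef_pV2 ?posrE ?exprn_gt0//.
  by rewrite ler_weXn2l// ltW// card_field_gt1.
case: M hM minM bM => // N hM minM bN; exists N => //; rewrite hM ltNge.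
by apply/negP => /minM; rewrite ltnn.
Qed.

Lemma topological_entropy_torus (b : nat) (h : R) :
  (forall N, (b <= N)%N -> (fun n => - ln (cell_prob n N) / n%:R) @ \oo --> h) ->
  topological_entropy (@torus_dist R F d) f = h%:E.
Proof.
move=> hc; rewrite /topological_entropy; apply/cvg_lim => //.
(* Every small [e] falls in a range of depth [N >= b], where the growth rate already equals [h]; the
   limit in [e] is that of an eventually constant function. *)
apply: cvg_near_cst.
have qb : 0 < q ^- b by rewrite invr_gt0 exprn_gt0// card_field_gt0.
apply: filterS2 (nbhs_right_gt 0) (nbhs_right_lt qb) => e e0 eb.
have [N bN he] := scale_ex e0 eb; rewrite /separated_growth.
rewrite (_ : (fun n => _) = (EFin \o (fun n => - ln (cell_prob n N) / n%:R))); last first.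
  by apply/funext => n; rewrite (max_separated_code _ he) /= -EFinM mulrC.
have cE : EFin \o (fun n => - ln (cell_prob n N) / n%:R) @ \oo --> h%:E.
  by apply: cvg_EFin; [exact: nearW|exact: hc].
by have [_ ->] := cvg_limn_einf_sup cE.
Qed.

End TopologicalEntropy.

Theorem theorem1p1 (R : realType) (F : finFieldType) (d : nat) (d_gt0 : (0 < d)%N)
  (A : 'M[{poly F}]_d) (detA : \det A != 0)
  (mu : probability (borel_torus F) R) (mu_haar : is_haar mu)
  (K : closedFieldType) (iota : {rmorphism laurent F -> K})
  (K_closure : is_algebraic_closure iota)
  (absK : K -> R) (absK_abs : is_absolute_value absK)
  (absK_ext : forall x : laurent F, absK (iota x) = labs R x)
  (lambda : 'I_d -> K)
  (lambda_eigen : char_poly (map_mx iota (map_mx (@laurent_of_poly F) A)) =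
                  \prod_(i < d) ('X - (lambda i)%:P)) :
  topological_entropy (@torus_dist R F d) (torus_mulmx A) =
    measure_entropy (prod_measure mu d) (torus_mulmx A) /\
  measure_entropy (prod_measure mu d) (torus_mulmx A) =
    (\sum_(i < d) ln (Num.max (absK (lambda i)) 1))%:E.
Proof.
have [b hb] := mx_lbound (map_mx (@laurent_of_poly F) A).
have hc N := @cell_prob_cvg _ _ _ mu_haar _ _ _ _ _ absK_abs absK_ext _ lambda_eigen b N hb.
have h0 : 0 <= \sum_(i < d) ln (Num.max (absK (lambda i)) 1).
  by apply: sumr_ge0 => i _; rewrite ln_ge0// le_max lexx orbT.
rewrite (topological_entropy_torus mu_haar hc).
by rewrite (measure_entropy_torus mu_haar detA h0 hc).
Qed.
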